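(* Let $\mathcal{N}$ be the basic Cohen model and let $X=\{x_n:n<\omega\}\in\mathcal{N}$ be its canonical Dedekind finite set of generic subsets of $\omega$. In $\mathcal{N}$ the maximum principle fails for the partial order $\mathbb{P}_0=\mathrm{Inj}(X,X)$.
   Context: Basic Cohen model. Let $M$ be a countable standard transitive model of ZFC. In $M$ let $\mathbb{P}=Fn(\omega\times\omega,2,\omega)$ be the poset of finite partial functions $p:D\to 2$, $D\subseteq\omega\times\omega$ finite, ordered by reverse inclusion. Each bijection $\tilde\pi:\omega\to\omega$ induces an automorphism $\pi$ of $\mathbb{P}$: for $p:D\to2$, $\pi(p)$ has domain $\{(\tilde\pi(i),j):(i,j)\in D\}$ and $\pi(p)(\tilde\pi(i),j)=p(i,j)$. Automorphisms act on $\mathbb{P}$-names by $\pi(\tau)=\{(\pi(p),\pi(\sigma)):(p,\sigma)\in\tau\}$. Let $\mathcal{G}$ be the group of automorphisms of $\mathbb{P}$ generated by $\{\pi_{i,j}: i<j<\omega\}$, where $\tilde\pi_{i,j}$ swaps $i$ and $j$ and fixes everything else. Let $H_n=\{\pi\in\mathcal{G}:\tilde\pi\upharpoonright n=\mathrm{id}\}$, and let $\mathcal{F}$ be the normal filter of subgroups of $\mathcal{G}$ generated by $\{H_n:n<\omega\}$. A $\mathbb{P}$-name $\tau\in M$ is symmetric if for some $n$ every $\pi\in H_n$ satisfies $\pi(\tau)=\tau$; it is hereditarily symmetric if it is symmetric and every $\sigma$ with $(p,\sigma)\in\tau$ for some $p$ is hereditarily symmetric. For $G$ $\mathbb{P}$-generic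 over $M$, the symmetric model $\mathcal{N}=\mathcal{N}_G=\{\tau^G:\tau\in M\text{ a hereditarily symmetric }\mathbb{P}\text{-name}\}$, a model of ZF with $M\subseteq\mathcal{N}\subseteq M[G]$, is the basic Cohen model. In $M[G]$ define $x_n=\{k<\omega:\exists p\in G\;\,p(n,k)=1\}$ and $X=\{x_n:n<\omega\}$. Then $X\in\mathcal{N}$, and in $\mathcal{N}$ the set $X$ is infinite and Dedekind finite. For infinite sets $I,J$, $\mathrm{Inj}(I,J)$ is the partial order of all finite injective partial maps from $I$ to $J$ (finite $r\subseteq I\times J$ that are graphs of one-to-one functions), ordered by reverse inclusion: $r_1\unlhd r_2$ iff $r_1\supseteq r_2$. For a partial order $\mathbb{Q}=(\mathbb{Q},\unlhd)$ the maximum principle for $\mathbb{Q}$ says: for every $p\in\mathbb{Q}$ and every formula $\theta(x)$ of set theory with $\mathbb{Q}$-names as parameters, $p\Vdash\exists x\,\theta(x)$ iff there exists a $\mathbb{Q}$-name $\tau$ with $p\Vdash\theta(\tau)$. Here $\Vdash$ is the usual forcing relation, defined in ZF without choice, with existential clause: $p\Vdash\exists x\,\theta(x)$ iff $\forall q\unlhd p\;\exists r\unlhd q\;\exists\tau$ a $\mathbb{Q}$-name with $r\Vdash\theta(\tau)$. ''In $\mathcal{N}$'' means that names and the forcing relation are those of $\mathcal{N}$; the principle fails for $\mathbb{Q}$ if some instance of it fails. *)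

(* Defs.v *)
From Stdlib Require Import List Arith Lia Wellfounded.
From Stdlib Require Import Classical ClassicalEpsilon FunctionalExtensionality
  PropExtensionality ProofIrrelevance.

Set Implicit Arguments.

(** * The universe of sets

    Aczel's well-founded trees, quotiented by bisimilarity so that
    extensionality holds for Leibniz equality. *)

Inductive tree : Type := Node (A : Type) (f : A -> tree).

Fixpoint teq (s t : tree) : Prop :=
  match s, t with
  | Node f, Node g =>
      (forall a, exists b, teq (f a) (g b)) /\ (forall b, exists a, teq (f a) (g b))
  end.

Definition tmem (s t : tree) : Prop :=
  match t with Node g => exists b, teq s (g b) end.

Definition V : Type := {c : tree -> Prop | exists t, c = teq t}.

Definition cls (t : tree) : V := exist _ (teq t) (ex_intro _ t eq_refl).

Definition rep (x : V) : tree :=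
  proj1_sig (constructive_indefinite_description _ (proj2_sig x)).

Definition mem (x y : V) : Prop := tmem (rep x) (rep y).

Declare Scope V_scope.
Delimit Scope V_scope with V.
Notation "x ∈ y" := (mem x y) (at level 70, no associativity) : V_scope.
Local Open Scope V_scope.

Lemma teq_refl t : teq t t.
Proof. induction t as [A f IH]; simpl; split; intros a; exists a; apply IH. Qed.

Lemma teq_sym s t : teq s t -> teq t s.
Proof.
  revert t; induction s as [A f IH]; intros [B g]; simpl; intros [H1 H2]; split.
  - intros b; destruct (H2 b) as [a Ha]; exists a; auto.
  - intros a; destruct (H1 a) as [b Hb]; exists b; auto.
Qed.

Lemma teq_trans s t u : teq s t -> teq t u -> teq s u.
Proof.
  revert t u; induction s as [A f IH]; intros [B g] [C h]; simpl.
  intros [H1 H2] [H3 H4]; split.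
  - intros a; destruct (H1 a) as [b Hb]; destruct (H3 b) as [c Hc]; exists c; eauto.
  - intros c; destruct (H4 c) as [b Hb]; destruct (H2 b) as [a Ha]; exists a; eauto.
Qed.

Lemma cls_eq s t : cls s = cls t <-> teq s t.
Proof.
  split; intros H.
  - assert (E : teq s = teq t) by exact (f_equal (@proj1_sig _ _) H).
    rewrite E; apply teq_refl.
  - assert (E : teq s = teq t).
    { extensionality u; apply propositional_extensionality; split; intros Hu.
      - eapply teq_trans; [apply teq_sym|]; eassumption.
      - eapply teq_trans; eassumption. }
    unfold cls; apply eq_sig_hprop; [intros; apply proof_irrelevance | exact E].
Qed.

Lemma cls_rep x : cls (rep x) = x.
Proof.
  unfold rep; destruct (constructive_indefinite_description _ (proj2_sig x)) as [t Ht].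
  simpl; unfold cls; apply eq_sig_hprop; [intros; apply proof_irrelevance |].
  simpl; now rewrite Ht.
Qed.

Lemma rep_cls t : teq (rep (cls t)) t.
Proof. apply cls_eq, cls_rep. Qed.

Lemma tmem_compat s s' t t' : teq s s' -> teq t t' -> tmem s t -> tmem s' t'.
Proof.
  destruct t as [A f], t' as [B g]; simpl; intros Hs [H1 _] [a Ha].
  destruct (H1 a) as [b Hb]; exists b.
  eapply teq_trans; [apply teq_sym, Hs |]; eapply teq_trans; eassumption.
Qed.

Lemma mem_cls s t : cls s ∈ cls t <-> tmem s t.
Proof.
  unfold mem; split; apply tmem_compat; first [apply rep_cls | apply teq_sym, rep_cls].
Qed.

Definition sup (A : Type) (f : A -> V) : V := cls (Node (fun a => rep (f a))).

Lemma mem_sup (A : Type) (f : A -> V) y : y ∈ sup f <-> exists a, y = f a.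
Proof.
  unfold sup; rewrite <- (cls_rep y) at 1; rewrite mem_cls; simpl.
  split; intros [a Ha]; exists a.
  - rewrite <- (cls_rep y), <- (cls_rep (f a)); now apply cls_eq.
  - subst y; apply teq_refl.
Qed.

Lemma V_sup x : exists (A : Type) (f : A -> V), x = sup f.
Proof.
  destruct (rep x) as [A f] eqn:E; exists A, (fun a => cls (f a)).
  rewrite <- (cls_rep x), E; apply cls_eq; simpl.
  split; intros a; exists a; [apply teq_sym|apply teq_sym]; apply rep_cls.
Qed.

Lemma V_ext x y : (forall z, z ∈ x <-> z ∈ y) -> x = y.
Proof.
  intros H; rewrite <- (cls_rep x), <- (cls_rep y); apply cls_eq.
  assert (H' : forall s, tmem s (rep x) <-> tmem s (rep y)).
  { intros s; rewrite <- !mem_cls, !cls_rep; apply H. }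
  destruct (rep x) as [A f], (rep y) as [B g]; simpl in *; split.
  - intros a; apply H'; exists a; apply teq_refl.
  - intros b; destruct (proj2 (H' (g b))) as [a Ha].
    + exists b; apply teq_refl.
    + exists a; now apply teq_sym.
Qed.

Lemma mem_wf : well_founded mem.
Proof.
  assert (H : forall t x, teq (rep x) t -> Acc mem x).
  { induction t as [A f IH]; intros x Hx; constructor; intros y Hy.
    assert (Hy' : tmem (rep y) (Node f)) by (eapply tmem_compat; [apply teq_refl | exact Hx | exact Hy]).
    destruct Hy' as [a Ha]; eapply IH; exact Ha. }
  intros x; apply (H (rep x)), teq_refl.
Qed.

Definition empty : V := sup (fun b : False => match b with end).

Lemma mem_empty z : ~ z ∈ empty.
Proof. unfold empty; rewrite mem_sup; intros [[] _]. Qed.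

(** A class is small when it is covered by a type-indexed family of sets. *)
Definition small (P : V -> Prop) : Prop :=
  exists (A : Type) (f : A -> V), forall y, P y -> exists a, y = f a.

(** [setOf P] is [{y | P y}]; it is a junk value when [P] is not small. *)
Definition setOf (P : V -> Prop) : V :=
  epsilon (inhabits empty) (fun x => forall y, y ∈ x <-> P y).

Lemma mem_setOf P y : small P -> y ∈ setOf P <-> P y.
Proof.
  intros (A & f & H); revert y; unfold setOf; apply epsilon_spec.
  exists (sup (fun i : {a | P (f a)} => f (proj1_sig i))).
  intros y; rewrite mem_sup; split.
  - intros [[a Ha] ->]; exact Ha.
  - intros Hy; destruct (H y Hy) as [a ->]; now exists (exist _ a Hy).
Qed.

Lemma small_image (x : V) (R : V -> V -> Prop) :
  (forall z y y', R z y -> R z y' -> y = y') -> small (fun y => exists z, z ∈ x /\ R z y).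
Proof.
  intros HR; destruct (V_sup x) as (A & f & ->).
  exists A, (fun a => epsilon (inhabits (sup f)) (R (f a))).
  intros y (z & Hz & Hy); apply mem_sup in Hz; destruct Hz as [a ->].
  exists a; apply (HR (f a)); [exact Hy | apply epsilon_spec; eauto].
Qed.

Lemma small_sub (P Q : V -> Prop) : (forall y, P y -> Q y) -> small Q -> small P.
Proof. intros H (A & f & Hf); exists A, f; auto. Qed.

(** ** Pairs and natural numbers *)

Definition upair (x y : V) : V := setOf (fun z => z = x \/ z = y).
Definition opair (x y : V) : V := upair (upair x x) (upair x y).
Notation "⟨ x , y ⟩" := (opair x y) (at level 0, x at level 99, y at level 99) : V_scope.

Lemma mem_upair x y z : z ∈ upair x y <-> z = x \/ z = y.
Proof.
  apply mem_setOf; exists bool, (fun b : bool => if b then x else y).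
  intros w [-> | ->]; [now exists true | now exists false].
Qed.

Lemma upair_inj x y x' y' :
  upair x y = upair x' y' -> (x = x' /\ y = y') \/ (x = y' /\ y = x').
Proof.
  intros E.
  assert (H : forall z, (z = x \/ z = y) <-> (z = x' \/ z = y')).
  { intros z; rewrite <- !mem_upair, E; reflexivity. }
  destruct (proj1 (H x) (or_introl eq_refl)), (proj1 (H y) (or_intror eq_refl)),
    (proj2 (H x') (or_introl eq_refl)), (proj2 (H y') (or_intror eq_refl));
    subst; auto.
Qed.

Lemma opair_inj x y x' y' : ⟨x, y⟩ = ⟨x', y'⟩ -> x = x' /\ y = y'.
Proof.
  intros E; apply upair_inj in E as [[E1 E2] | [E1 E2]];
    apply upair_inj in E1; apply upair_inj in E2; intuition congruence.
Qed.

Fixpoint num (n : nat) : V :=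
  match n with
  | 0 => empty
  | S m => setOf (fun z => z ∈ num m \/ z = num m)
  end.

Lemma mem_num n z : z ∈ num n <-> exists k, k < n /\ z = num k.
Proof.
  revert z; induction n as [|n IH]; intros z.
  - split; [intros H; now apply mem_empty in H | intros (k & Hk & _); lia].
  - cbn [num]; rewrite mem_setOf.
    + rewrite IH; split.
      * intros [(k & Hk & ->) | ->]; [exists k | exists n]; auto with arith.
      * intros (k & Hk & ->); destruct (Nat.eq_dec k n) as [-> | Hn]; [now right |].
        left; exists k; split; [lia | reflexivity].
    + exists nat, num; intros y; rewrite IH; intros [(k & _ & ->) | ->]; eauto.
Qed.

Lemma num_inj m n : num m = num n -> m = n.
Proof.
  assert (irr : forall x, ~ x ∈ x).
  { intros x; induction x as [x IH] using (well_founded_ind mem_wf); intros H; exact (IH x H H). }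
  intros E; destruct (lt_eq_lt_dec m n) as [[H | H] | H]; auto; exfalso.
  - apply (irr (num n)); rewrite <- E at 1; apply mem_num; eauto.
  - apply (irr (num m)); rewrite E at 1; apply mem_num; eauto.
Qed.

(** * Formulas of set theory and models of ZFC

    De Bruijn variables: [fEx] binds index 0 and shifts the others. The
    remaining connectives and the universal quantifier are abbreviations. *)

Inductive form : Type :=
| fMem (i j : nat)
| fEq (i j : nat)
| fNot (phi : form)
| fAnd (phi psi : form)
| fEx (phi : form).

Definition scons (x : V) (e : nat -> V) (i : nat) : V :=
  match i with 0 => x | S j => e j end.

Fixpoint sat (C : V -> Prop) (e : nat -> V) (phi : form) : Prop :=
  match phi with
  | fMem i j => e i ∈ e j
  | fEq i j => e i = e j
  | fNot phi => ~ sat C e phi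
  | fAnd phi psi => sat C e phi /\ sat C e psi
  | fEx phi => exists x, C x /\ sat C (scons x e) phi
  end.

Record ZFC (C : V -> Prop) : Prop := {
  zfc_extensionality : forall x y, C x -> C y ->
    (forall z, C z -> (z ∈ x <-> z ∈ y)) -> x = y;
  zfc_foundation : forall x, C x -> (exists y, C y /\ y ∈ x) ->
    exists y, C y /\ y ∈ x /\ ~ exists z, C z /\ z ∈ x /\ z ∈ y;
  zfc_pairing : forall x y, C x -> C y -> exists z, C z /\ x ∈ z /\ y ∈ z;
  zfc_union : forall x, C x -> exists u, C u /\
    forall y z, C y -> C z -> z ∈ y -> y ∈ x -> z ∈ u;
  zfc_powerset : forall x, C x -> exists p, C p /\
    forall y, C y -> (forall z, C z -> z ∈ y -> z ∈ x) -> y ∈ p;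
  zfc_infinity : exists w, C w /\
    (exists o, C o /\ o ∈ w /\ forall z, C z -> ~ z ∈ o) /\
    (forall n, C n -> n ∈ w -> exists s, C s /\ s ∈ w /\
       forall z, C z -> (z ∈ s <-> z ∈ n \/ z = n));
  zfc_separation : forall phi e a, (forall i, C (e i)) -> C a -> exists b, C b /\
    forall x, C x -> (x ∈ b <-> x ∈ a /\ sat C (scons x e) phi);
  zfc_replacement : forall phi e a, (forall i, C (e i)) -> C a ->
    (forall x, C x -> x ∈ a -> exists! y, C y /\ sat C (scons y (scons x e)) phi) ->
    exists b, C b /\ forall x, C x -> x ∈ a ->
      exists y, C y /\ y ∈ b /\ sat C (scons y (scons x e)) phi;
  zfc_choice : forall a, C a ->
    (forall x, C x -> x ∈ a -> exists z, C z /\ z ∈ x) ->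
    (forall x y z, C x -> C y -> C z -> x ∈ a -> y ∈ a -> z ∈ x -> z ∈ y -> x = y) ->
    exists c, C c /\ forall x, C x -> x ∈ a -> exists! z, C z /\ z ∈ c /\ z ∈ x
}.

Record ctm (M : V -> Prop) : Prop := {
  ctm_countable : exists f : nat -> V, forall x, M x -> exists n, x = f n;
  ctm_transitive : forall x y, M x -> y ∈ x -> M y;
  ctm_zfc : ZFC M
}.

(** * Names and forcing

    [P] is the class of conditions of a partial order and [le] its order;
    [le q p] says that [q] is stronger than [p]. *)

Inductive is_name (P : V -> Prop) (t : V) : Prop :=
  is_name_intro : (forall z, z ∈ t -> exists p s, z = ⟨p, s⟩ /\ P p /\ is_name P s) ->
  is_name P t.

(** The recursion defining [p ⊩ a = b] descends along members of the names
    [a] and [b]; as these are well-founded, its unique solution is the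
    inductive predicate below. *)
Inductive forces_eq (P : V -> Prop) (le : V -> V -> Prop) : V -> V -> V -> Prop :=
  forces_eq_intro p a b :
    (forall q s c, P q -> le q p -> ⟨s, c⟩ ∈ a -> le q s ->
       exists r t d, P r /\ le r q /\ ⟨t, d⟩ ∈ b /\ le r t /\ forces_eq P le r c d) ->
    (forall q t d, P q -> le q p -> ⟨t, d⟩ ∈ b -> le q t ->
       exists r s c, P r /\ le r q /\ ⟨s, c⟩ ∈ a /\ le r s /\ forces_eq P le r c d) ->
    forces_eq P le p a b.

Definition forces_mem (P : V -> Prop) (le : V -> V -> Prop) (p a b : V) : Prop :=
  forall q, P q -> le q p ->
    exists r t d, P r /\ le r q /\ ⟨t, d⟩ ∈ b /\ le r t /\ forces_eq P le r a d.

(** The forcing relation of a transitive class [C], for a partial order whose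
    conditions lie in [C]: names range over [C]. The environment [e] supplies
    the parameters. *)
Fixpoint forces (C P : V -> Prop) (le : V -> V -> Prop)
    (p : V) (e : nat -> V) (phi : form) : Prop :=
  match phi with
  | fMem i j => forces_mem P le p (e i) (e j)
  | fEq i j => forces_eq P le p (e i) (e j)
  | fNot phi => forall q, P q -> le q p -> ~ forces C P le q e phi
  | fAnd phi psi => forces C P le p e phi /\ forces C P le p e psi
  | fEx phi => forall q, P q -> le q p ->
      exists r, P r /\ le r q /\
        exists t, C t /\ is_name P t /\ forces C P le r (scons t e) phi
  end.

(** The existentially quantified variable of [theta] is index 0. *)
Definition maximum_principle (C P : V -> Prop) (le : V -> V -> Prop) : Prop :=
  forall p, P p -> forall (theta : form) (e : nat -> V),
    (forall i, C (e i) /\ is_name P (e i)) ->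
    (forces C P le p e (fEx theta) <->
     exists t, C t /\ is_name P t /\ forces C P le p (scons t e) theta).

(** * The partial orders

    Both consist of finite sets ordered by reverse inclusion and are taken
    inside a transitive class [C]. For transitive models of ZF, finiteness in
    the model agrees with finiteness. *)

Definition finite (x : V) : Prop := exists l : list V, forall z, z ∈ x -> In z l.

Definition rev_incl (q p : V) : Prop := forall z, z ∈ p -> z ∈ q.

Definition Fn (C : V -> Prop) (p : V) : Prop :=
  C p /\ finite p /\
  (forall z, z ∈ p -> exists i j b, b < 2 /\ z = ⟨⟨num i, num j⟩, num b⟩) /\
  (forall u v w, ⟨u, v⟩ ∈ p -> ⟨u, w⟩ ∈ p -> v = w).

Definition Inj (C : V -> Prop) (I J r : V) : Prop :=
  C r /\ finite r /\
  (forall z, z ∈ r -> exists x y, x ∈ I /\ y ∈ J /\ z = ⟨x, y⟩) /\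
  (forall x y y', ⟨x, y⟩ ∈ r -> ⟨x, y'⟩ ∈ r -> y = y') /\
  (forall x x' y, ⟨x, y⟩ ∈ r -> ⟨x', y⟩ ∈ r -> x = x').

Definition generic (M P : V -> Prop) (le : V -> V -> Prop) (G : V -> Prop) : Prop :=
  (forall p, G p -> P p) /\
  (exists p, G p) /\
  (forall p q, G p -> P q -> le p q -> G q) /\
  (forall p q, G p -> G q -> exists r, G r /\ le r p /\ le r q) /\
  (forall D, M D -> (forall d, d ∈ D -> P d) ->
     (forall p, P p -> exists d, d ∈ D /\ le d p) -> exists d, d ∈ D /\ G d).

(** * Evaluation of names and the action of automorphisms *)

Definition in_name (s t : V) : Prop := exists p, ⟨p, s⟩ ∈ t.

Lemma in_name_wf : well_founded in_name.
Proof.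
  apply (wf_incl _ _ _) with (2 := wf_clos_trans _ _ mem_wf).
  intros s t [p H].
  apply Relation_Operators.t_trans with (upair p s).
  - apply Relation_Operators.t_step, mem_upair; now right.
  - apply Relation_Operators.t_trans with ⟨p, s⟩; apply Relation_Operators.t_step; [|exact H].
    apply mem_upair; now right.
Qed.

Definition val (G : V -> Prop) : V -> V :=
  Fix in_name_wf (fun _ => V) (fun t rec =>
    setOf (fun y => exists p s (h : ⟨p, s⟩ ∈ t), G p /\ y = rec s (ex_intro _ p h))).

Lemma mem_val G t y : y ∈ val G t <-> exists p s, ⟨p, s⟩ ∈ t /\ G p /\ y = val G s.
Proof.
  unfold val at 1; rewrite Fix_eq; fold (val G).
  - rewrite mem_setOf; [split; intros (p & s & h & H); exists p, s; [|exists h]; tauto |].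
    eapply small_sub;
      [| apply (small_image t (fun z y => exists p s, z = ⟨p, s⟩ /\ y = val G s))].
    + intros w (p & s & h & _ & ->); exists ⟨p, s⟩; eauto.
    + intros z w w' (p & s & -> & ->) (p' & s' & E & ->).
      now apply opair_inj in E as [_ ->].
  - intros x f g H; f_equal; extensionality w; apply propositional_extensionality.
    split; intros (p & s & h & Hp & ->); exists p, s, h; [rewrite H | rewrite <- H]; auto.
Qed.

(** [act_cond f] is the automorphism of [Fn(ω×ω,2,ω)] induced by the bijection
    [f] of ω, and [act f] its extension to names. *)
Definition act_cond (f : nat -> nat) (p : V) : V :=
  setOf (fun z => exists i j b, ⟨⟨num i, num j⟩, b⟩ ∈ p /\ z = ⟨⟨num (f i), num j⟩, b⟩).

Definition act (f : nat -> nat) : V -> V :=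
  Fix in_name_wf (fun _ => V) (fun t rec =>
    setOf (fun z => exists p s (h : ⟨p, s⟩ ∈ t),
      z = ⟨act_cond f p, rec s (ex_intro _ p h)⟩)).

Lemma mem_act_cond f p z : z ∈ act_cond f p <->
  exists i j b, ⟨⟨num i, num j⟩, b⟩ ∈ p /\ z = ⟨⟨num (f i), num j⟩, b⟩.
Proof.
  apply mem_setOf.
  eapply small_sub; [| apply (small_image p (fun u y => exists i j b,
    u = ⟨⟨num i, num j⟩, b⟩ /\ y = ⟨⟨num (f i), num j⟩, b⟩))].
  - intros w (i & j & b & h & ->); exists ⟨⟨num i, num j⟩, b⟩; eauto 6.
  - intros u w w' (i & j & b & -> & ->) (i' & j' & b' & E & ->).
    apply opair_inj in E as [E ->]; apply opair_inj in E as [E1 E2].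
    now rewrite (num_inj _ _ E1), E2.
Qed.

Lemma mem_act f t z :
  z ∈ act f t <-> exists p s, ⟨p, s⟩ ∈ t /\ z = ⟨act_cond f p, act f s⟩.
Proof.
  unfold act at 1; rewrite Fix_eq; fold (act f).
  - rewrite mem_setOf; [split; intros (p & s & h & H); exists p, s; [|exists h]; tauto |].
    eapply small_sub; [| apply (small_image t (fun u y => exists p s,
      u = ⟨p, s⟩ /\ y = ⟨act_cond f p, act f s⟩))].
    + intros w (p & s & h & ->); exists ⟨p, s⟩; eauto.
    + intros u w w' (p & s & -> & ->) (p' & s' & E & ->).
      now apply opair_inj in E as [-> ->].
  - intros x g h' H; f_equal; extensionality w; apply propositional_extensionality.
    split; intros (p & s & h & ->); exists p, s, h; [rewrite H | rewrite <- H]; auto.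
Qed.

(** * The basic Cohen model *)

Definition swap (i j n : nat) : nat :=
  if n =? i then j else if n =? j then i else n.

(** The group 𝒢 generated by the transpositions; an element is given by the
    bijection of ω that induces it. The generators are involutions, so
    products of generators suffice. *)
Inductive Grp : (nat -> nat) -> Prop :=
| Grp_id : Grp (fun n => n)
| Grp_swap i j f : i < j -> Grp f -> Grp (fun n => swap i j (f n)).

(** The subgroup H_n of 𝒢. *)
Definition fix_below (n : nat) (f : nat -> nat) : Prop := Grp f /\ forall i, i < n -> f i = i.

Definition symmetric (t : V) : Prop := exists n, forall f, fix_below n f -> act f t = t.

Inductive hereditarily_symmetric (t : V) : Prop :=
  hereditarily_symmetric_intro :
    symmetric t ->
    (forall p s, ⟨p, s⟩ ∈ t -> hereditarily_symmetric s) ->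
    hereditarily_symmetric t.

Definition cohen_model (M G : V -> Prop) (x : V) : Prop :=
  exists t, M t /\ is_name (Fn M) t /\ hereditarily_symmetric t /\ x = val G t.

Definition cohen_real (G : V -> Prop) (n : nat) : V :=
  setOf (fun z => exists k p, G p /\ ⟨⟨num n, num k⟩, num 1⟩ ∈ p /\ z = num k).

Definition cohen_set (G : V -> Prop) : V :=
  setOf (fun x => exists n, x = cohen_real G n).

Lemma mem_cohen_real G n z : z ∈ cohen_real G n <->
  exists k p, G p /\ ⟨⟨num n, num k⟩, num 1⟩ ∈ p /\ z = num k.
Proof. apply mem_setOf; exists nat, num; intros y (k & p & _ & _ & ->); eauto. Qed.

Lemma mem_cohen_set G x : x ∈ cohen_set G <-> exists n, x = cohen_real G n.
Proof. apply mem_setOf; exists nat, (cohen_real G); auto. Qed.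

(* Main.v *)
From Stdlib Require Import List Arith Lia Classical ClassicalEpsilon
  FunctionalExtensionality PropExtensionality.
Require Import Defs.

(** In the poset of finite injections of X let σ name the set of fixed points of
    the generic bijection, each x ∈ X being coded by a name [value x]. By
    genericity it is forced that σ is non-empty. Suppose a name t of the symmetric
    model were forced to be a member of σ. Let n bound the support of a Cohen name
    of t. Below a condition without fixed points among the first n reals, some r
    forces t to be the code of x_a with a ≥ n and (x_a, x_a) ∈ r. This fact about
    M[G] is decided by a Cohen condition p ∈ G. For a fresh b with π p ∈ G, where π
    is the transposition of a and b, the filter π G is generic and contains p; it
    yields the same X and the same t, but exchanges x_a and x_b. Hence π r forces t
    to be the code of x_b. As r and π r are compatible, this is absurd.

    Passing from G to π G only uses that val (π G) t = val G (π t), so the action of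
    automorphisms on names need not be carried out inside M. *)

Local Open Scope V_scope.

(** * Definability over a family of classes *)

(** The instance that fails is [v ∈ σ] with [v] quantified, at the weakest condition. Forcing an
    atomic formula depends only on the conditions and on the two names, not on the class over which
    names range. Every finite injection of X has a hereditarily symmetric name, so the poset of the
    symmetric model is that of M[G], and the crucial statement, that [r] forces [t] to equal a code,
    can be studied in M[G] by the forcing theorem for Cohen forcing. One Cohen condition can decide
    this statement for G and for π G only if the same formula, with the same names as parameters,
    expresses it in every generic extension. This is why definability is developed over families of
    classes: M is a family with one member, and the extensions M[G] form a family indexed by the
    generic filters. A Cohen real is not itself a name for the poset of injections. Its code is
    built from canonical names, so that no condition can force the codes of two different reals to
    be equal. The name of t is moved by π unless both a and b lie above its support; the bound on a
    is obtained by starting from a condition that sends each of the first n reals to the next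
    one. *)

Fixpoint ren (f : nat -> nat) (phi : form) : form :=
  match phi with
  | fMem i j => fMem (f i) (f j)
  | fEq i j => fEq (f i) (f j)
  | fNot phi => fNot (ren f phi)
  | fAnd phi psi => fAnd (ren f phi) (ren f psi)
  | fEx phi => fEx (ren (fun n => match n with 0 => 0 | S m => S (f m) end) phi)
  end.

Lemma sat_ren C phi : forall f e, sat C e (ren f phi) <-> sat C (fun n => e (f n)) phi.
Proof.
  induction phi as [i j | i j | phi IH | phi IH1 psi IH2 | phi IH]; intros f e; simpl.
  - reflexivity.
  - reflexivity.
  - rewrite IH; reflexivity.
  - rewrite IH1, IH2; reflexivity.
  - assert (E : forall x, (fun n => scons x e (match n with 0 => 0 | S m => S (f m) end))
                   = scons x (fun n => e (f n))).
    { intros x; extensionality n; now destruct n. }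
    split; intros (x & Hx & H); exists x; split; auto.
    + rewrite IH, E in H; exact H.
    + rewrite IH, E; exact H.
Qed.

Fixpoint parity (n : nat) : nat + nat :=
  match n with
  | 0 => inl 0
  | 1 => inr 0
  | S (S n) => match parity n with inl k => inl (S k) | inr k => inr (S k) end
  end.

(** Variables and parameters are both infinite sequences. Interleaving them leaves room for further
    ones of either kind, so formulas can be combined without counting free variables. *)
Definition mix {A : Type} (e c : nat -> A) (n : nat) : A :=
  match parity n with inl k => e k | inr k => c k end.

Lemma parity_even k : parity (2 * k) = inl k.
Proof.
  induction k as [|k IH]; [reflexivity |].
  replace (2 * S k) with (S (S (2 * k))) by lia; cbn [parity]; now rewrite IH.
Qed.

Lemma parity_odd k : parity (S (2 * k)) = inr k.
Proof.
  induction k as [|k IH]; [reflexivity |].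
  replace (S (2 * S k)) with (S (S (S (2 * k)))) by lia.
  change (match parity (S (2 * k)) with inl k => inl (S k) | inr k => inr (S k) end
    = @inr nat nat (S k)); now rewrite IH.
Qed.

Lemma mix_even {A} (e c : nat -> A) k : mix e c (2 * k) = e k.
Proof. unfold mix; now rewrite parity_even. Qed.

Lemma mix_odd {A} (e c : nat -> A) k : mix e c (S (2 * k)) = c k.
Proof. unfold mix; now rewrite parity_odd. Qed.

Lemma mix_comp {A} (X : nat -> A) f g :
  (fun n => X (mix f g n)) = mix (fun k => X (f k)) (fun k => X (g k)).
Proof. extensionality n; unfold mix; now destruct (parity n). Qed.

(** A family of transitive classes is treated uniformly, so that one formula
    serves all of its members; [fam_const] says which functions of the index
    are allowed as parameters. *)
Record family : Type := {
  fam_ix : Type;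
  fam_cl : fam_ix -> V -> Prop;
  fam_const : (fam_ix -> V) -> Prop;
  fam_const_cl : forall c, fam_const c -> forall i, fam_cl i (c i);
  fam_const_empty : fam_const (fun _ => empty);
  fam_trans : forall i x y, fam_cl i x -> y ∈ x -> fam_cl i y;
  fam_upair : forall i x y, fam_cl i x -> fam_cl i y -> fam_cl i (upair x y);
  fam_sep : forall i phi e a, (forall n, fam_cl i (e n)) -> fam_cl i a ->
    exists b, fam_cl i b /\ forall x, x ∈ b <-> x ∈ a /\ sat (fam_cl i) (scons x e) phi
}.

(** Binding a variable shifts every position by one and so exchanges the parities: the old variable
    k moves to 2k + 1 and the parameter k to 2k + 2, while the bound variable takes position 0. *)
Lemma sat_ren_scons C x e c phi :
  sat C (scons x (mix e c)) (ren (mix (fun k => match k with 0 => 0 | S k => S (2 * k) end)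
     (fun k => S (S (2 * k)))) phi) <-> sat C (mix (scons x e) c) phi.
Proof.
  rewrite sat_ren, mix_comp.
  match goal with |- sat _ ?a _ <-> sat _ ?b _ => replace a with b; [reflexivity |] end.
  f_equal; extensionality k.
  - destruct k; cbn -[Nat.mul]; [reflexivity |]; now rewrite mix_even.
  - change (c k = mix e c (S (2 * k))); now rewrite mix_odd.
Qed.

Section Definability.

Context {U : family}.
Notation C := (fam_cl U).

(* In [mix e c] the variables occupy the even positions and the parameters the odd ones. *)
Definition definable (R : fam_ix U -> (nat -> V) -> Prop) : Prop :=
  exists phi c, (forall n, fam_const U (c n)) /\
    forall i e, (forall n, C i (e n)) -> (sat (C i) (mix e (fun n => c n i)) phi <-> R i e).

(** The value must lie in the class because a term is substituted into a formula by quantifying over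
    the class; see [definable_subst]. *)
Definition definable_term (t : fam_ix U -> (nat -> V) -> V) : Prop :=
  (forall i e, (forall n, C i (e n)) -> C i (t i e)) /\
  definable (fun i e => e 0 = t i (fun n => e (S n))).

Lemma scons_cl i x e : C i x -> (forall n, C i (e n)) -> forall n, C i (scons x e n).
Proof. intros Hx He [|n]; simpl; auto. Qed.

Lemma definable_iff (R R' : fam_ix U -> (nat -> V) -> Prop) :
  (forall i e, (forall n, C i (e n)) -> (R' i e <-> R i e)) -> definable R -> definable R'.
Proof.
  intros H (phi & c & Hc & Hphi); exists phi, c; split; auto.
  intros i e He; rewrite H by auto; auto.
Qed.

Lemma definable_ren R (f : nat -> nat) :
  definable R -> definable (fun i e => R i (fun n => e (f n))).
Proof.
  intros (phi & c & Hc & Hphi).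
  exists (ren (mix (fun k => 2 * f k) (fun k => S (2 * k))) phi), c; split; auto.
  intros i e He; rewrite sat_ren, mix_comp.
  rewrite <- Hphi by auto.
  replace (fun k => mix e (fun n => c n i) (2 * f k)) with (fun n => e (f n))
    by (extensionality k; now rewrite mix_even).
  replace (fun k => mix e (fun n => c n i) (S (2 * k))) with (fun n => c n i)
    by (extensionality k; now rewrite mix_odd).
  reflexivity.
Qed.

Lemma definable_not R : definable R -> definable (fun i e => ~ R i e).
Proof.
  intros (phi & c & Hc & Hphi); exists (fNot phi), c; split; auto.
  intros i e He; simpl; rewrite Hphi by auto; reflexivity.
Qed.

Lemma definable_and R R2 :
  definable R -> definable R2 -> definable (fun i e => R i e /\ R2 i e).
Proof.
  intros (phi & c & Hc & Hphi) (psi & d & Hd & Hpsi).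
  (* The parameters of the two formulas are themselves interleaved: [phi] uses the even entries of
     [mix c d] and [psi] the odd ones. *)
  exists (fAnd (ren (mix (fun k => 2 * k) (fun k => S (2 * (2 * k)))) phi)
     (ren (mix (fun k => 2 * k) (fun k => S (2 * (S (2 * k))))) psi)), (mix c d).
  split; [intros n; unfold mix; destruct (parity n); auto |].
  intros i e He; cbn [sat]; rewrite !sat_ren, !mix_comp, <- Hphi, <- Hpsi by auto.
  replace (fun k => mix e (fun n => mix c d n i) (2 * k)) with e
    by (extensionality k; now rewrite mix_even).
  replace (fun k => mix e (fun n => mix c d n i) (S (2 * (2 * k)))) with (fun n => c n i)
    by (extensionality k; now rewrite mix_odd, mix_even).
  replace (fun k => mix e (fun n => mix c d n i) (S (2 * S (2 * k)))) with (fun n => d n i)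
    by (extensionality k; now rewrite mix_odd, mix_odd).
  reflexivity.
Qed.

Lemma definable_ex (R : fam_ix U -> V -> (nat -> V) -> Prop) :
  definable (fun i e => R i (e 0) (fun n => e (S n))) ->
  definable (fun i e => exists x, C i x /\ R i x e).
Proof.
  intros (phi & c & Hc & Hphi).
  exists (fEx (ren (mix (fun k => match k with 0 => 0 | S k => S (2 * k) end)
     (fun k => S (S (2 * k)))) phi)), c.
  split; auto; intros i e He; simpl.
  assert (E : forall x, C i x -> (sat (C i) (scons x (mix e (fun n => c n i)))
    (ren (mix (fun k => match k with 0 => 0 | S k => S (2 * k) end)
       (fun k => S (S (2 * k)))) phi) <-> R i x e)).
  { intros x Hx; rewrite sat_ren_scons.
    apply (Hphi i (scons x e) (scons_cl i x e Hx He)). }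
  split; intros (x & Hx & H); exists x; split; auto; now apply E.
Qed.

Lemma definable_or R R2 :
  definable R -> definable R2 -> definable (fun i e => R i e \/ R2 i e).
Proof.
  intros HR HS.
  apply definable_iff with (fun i e => ~ (~ R i e /\ ~ R2 i e)); [intros; tauto |].
  apply definable_not, definable_and; now apply definable_not.
Qed.

Lemma definable_imp R R2 :
  definable R -> definable R2 -> definable (fun i e => R i e -> R2 i e).
Proof.
  intros HR HS.
  apply definable_iff with (fun i e => ~ (R i e /\ ~ R2 i e)); [intros; tauto |].
  apply definable_not, definable_and; [|apply definable_not]; auto.
Qed.

Lemma definable_equiv R R2 :
  definable R -> definable R2 -> definable (fun i e => R i e <-> R2 i e).
Proof.
  intros HR HS.
  apply definable_iff with (fun i e => (R i e -> R2 i e) /\ (R2 i e -> R i e)); [intros; tauto |].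
  apply definable_and; now apply definable_imp.
Qed.

Lemma definable_all (R : fam_ix U -> V -> (nat -> V) -> Prop) :
  definable (fun i e => R i (e 0) (fun n => e (S n))) ->
  definable (fun i e => forall x, C i x -> R i x e).
Proof.
  intros H.
  apply definable_iff with (fun i e => ~ exists x, C i x /\ ~ R i x e).
  - intros i e He; split.
    + intros A (x & Hx & B); auto.
    + intros A x Hx; apply NNPP; intros B; apply A; eauto.
  - apply definable_not, definable_ex, definable_not, H.
Qed.

Lemma definable_mem_var m n : definable (fun _ e => e m ∈ e n).
Proof.
  exists (fMem (2 * m) (2 * n)), (fun _ _ => empty); split.
  - intros; apply fam_const_empty.
  - intros i e _; cbn [sat]; rewrite !mix_even; reflexivity.
Qed.

Lemma definable_eq_var m n : definable (fun _ e => e m = e n).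
Proof.
  exists (fEq (2 * m) (2 * n)), (fun _ _ => empty); split.
  - intros; apply fam_const_empty.
  - intros i e _; cbn [sat]; rewrite !mix_even; reflexivity.
Qed.

Lemma definable_var n : definable_term (fun _ e => e n).
Proof. split; auto; apply definable_eq_var. Qed.

Lemma definable_const c : fam_const U c -> definable_term (fun i _ => c i).
Proof.
  intros Hc; split; [intros i e _; now apply fam_const_cl |].
  exists (fEq (2 * 0) (S (2 * 0))), (fun _ => c); split; auto.
  intros i e _; cbn [sat]; rewrite mix_even, mix_odd; reflexivity.
Qed.

Lemma definable_subst (R : fam_ix U -> V -> (nat -> V) -> Prop) t :
  definable (fun i e => R i (e 0) (fun n => e (S n))) -> definable_term t ->
  definable (fun i e => R i (t i e) e).
Proof.
  intros HR [Ht1 Ht2].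
  apply definable_iff with (fun i e => exists x, C i x /\ (x = t i e /\ R i x e)).
  - intros i e He; split.
    + intros H; exists (t i e); auto.
    + intros (x & _ & -> & H); exact H.
  - apply definable_ex, definable_and; auto.
Qed.

Lemma definable_mem t u :
  definable_term t -> definable_term u -> definable (fun i e => t i e ∈ u i e).
Proof.
  intros Ht Hu.
  apply (definable_subst (fun i x e => x ∈ u i e) t); auto.
  apply (definable_subst (fun i x e => e 0 ∈ x) (fun i e => u i (fun n => e (S n)))).
  - apply (definable_mem_var 1 0).
  - destruct Hu as [Hu1 Hu2]; split; [intros; apply Hu1; auto |].
    apply (definable_ren _ (fun n => match n with 0 => 0 | S n => S (S n) end)) in Hu2; exact Hu2.
Qed.

Lemma definable_eq t u :
  definable_term t -> definable_term u -> definable (fun i e => t i e = u i e).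
Proof.
  intros Ht [_ Hu]; apply (definable_subst (fun i x e => x = u i e) t); auto.
Qed.

Lemma definable_term_ren t (f : nat -> nat) :
  definable_term t -> definable_term (fun i e => t i (fun n => e (f n))).
Proof.
  intros [H1 H2]; split; [intros; apply H1; auto |].
  apply (definable_ren _ (fun n => match n with 0 => 0 | S n => S (f n) end)) in H2; exact H2.
Qed.

(** A set is determined by its members, and by transitivity these lie in the class. A definition of
    membership in the term therefore defines its graph. *)
Lemma definable_term_intro (t : fam_ix U -> (nat -> V) -> V)
    (R : fam_ix U -> V -> (nat -> V) -> Prop) :
  (forall i e, (forall n, C i (e n)) -> C i (t i e)) ->
  (forall i e x, (forall n, C i (e n)) -> C i x -> (x ∈ t i e <-> R i x e)) ->
  definable (fun i e => R i (e 0) (fun n => e (S n))) ->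
  definable_term t.
Proof.
  intros H1 H2 HR; split; auto.
  apply definable_iff with
    (fun i e => forall x, C i x -> (x ∈ e 0 <-> R i x (fun n => e (S n)))).
  - intros i e He; split.
    + intros E x Hx; rewrite E; auto.
    + intros H; apply V_ext; intros x; split; intros Hx.
      * assert (C i x) by (eapply fam_trans; [apply (He 0) | auto]).
        apply H2; auto; apply H; auto.
      * assert (C i x) by (eapply fam_trans; [apply (H1 i (fun n => e (S n))); auto | auto]).
        apply H; auto; apply H2; auto.
  - apply definable_all, definable_equiv; [apply (definable_mem_var 0 1) |].
    apply (definable_ren _ (fun n => match n with 0 => 0 | S n => S (S n) end)) in HR; exact HR.
Qed.

Lemma definable_upair t u : definable_term t -> definable_term u ->
  definable_term (fun i e => upair (t i e) (u i e)).
Proof.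
  intros Ht Hu; apply definable_term_intro with (fun i x e => x = t i e \/ x = u i e).
  - intros i e He; apply fam_upair; [apply Ht | apply Hu]; auto.
  - intros; apply mem_upair.
  - apply definable_or; [apply Ht | apply Hu].
Qed.

Lemma definable_opair t u : definable_term t -> definable_term u ->
  definable_term (fun i e => ⟨t i e, u i e⟩).
Proof. intros Ht Hu; unfold opair; repeat apply definable_upair; auto. Qed.

Lemma definable_rev_incl t u : definable_term t -> definable_term u ->
  definable (fun i e => rev_incl (t i e) (u i e)).
Proof.
  intros Ht Hu.
  apply definable_iff with (fun i e => forall z, C i z -> z ∈ u i e -> z ∈ t i e).
  - intros i e He; unfold rev_incl; split; auto; intros H z Hz; apply H; auto.
    eapply fam_trans; [apply Hu; exact He | exact Hz].
  - apply definable_all, definable_imp; apply definable_mem; try apply (definable_var 0);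
      now apply (definable_term_ren _ S).
Qed.

Lemma opair_cl i x y : C i x -> C i y -> C i ⟨x, y⟩.
Proof. intros; unfold opair; repeat apply fam_upair; auto. Qed.

Lemma opair_cl_inv i x y : C i ⟨x, y⟩ -> C i x /\ C i y.
Proof.
  intros H.
  assert (H' : C i (upair x y)).
  { eapply fam_trans; [exact H |]; apply mem_upair; auto. }
  split; (eapply fam_trans; [exact H' |]); apply mem_upair; auto.
Qed.

Lemma opair_mem_cl i x y z : C i z -> ⟨x, y⟩ ∈ z -> C i x /\ C i y.
Proof. intros Hz H; apply opair_cl_inv; eapply fam_trans; eauto. Qed.

Lemma definable_sep (R : fam_ix U -> V -> (nat -> V) -> Prop) i e a :
  definable (fun i e => R i (e 0) (fun n => e (S n))) ->
  (forall n, C i (e n)) -> C i a ->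
  exists b, C i b /\ forall x, x ∈ b <-> x ∈ a /\ R i x e.
Proof.
  intros (phi & c & Hc & Hphi) He Ha.
  destruct (fam_sep U i (ren (mix (fun k => match k with 0 => 0 | S k => S (2 * k) end)
     (fun k => S (S (2 * k)))) phi) (mix e (fun n => c n i)) a) as (b & Hb & H); auto.
  { intros n; unfold mix; destruct (parity n); auto; now apply fam_const_cl. }
  exists b; split; auto; intros x; rewrite H, sat_ren_scons.
  assert (E : x ∈ a -> (sat (C i) (mix (scons x e) (fun n => c n i)) phi <-> R i x e)).
  { intros Hx; rewrite (Hphi i (scons x e)); [reflexivity |].
    apply scons_cl; auto; exact (fam_trans U i a x Ha Hx). }
  tauto.
Qed.

End Definability.

Create HintDb definability.

(** The formula is read off from the shape of the statement. Below, each quantifier is therefore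
    followed at once by its own restriction to the class, and bounded or multiple quantifiers are
    spelled out in this form. *)
Ltac definability :=
  repeat (cbn beta; first [ assumption | solve [auto with definability nocore] | match goal with
    | |- @definable ?U (fun i e => @?R i e /\ @?S i e) => apply (@definable_and U)
    | |- @definable ?U (fun i e => @?R i e \/ @?S i e) => apply (@definable_or U)
    | |- @definable ?U (fun i e => ~ @?R i e) => apply (@definable_not U)
    | |- @definable ?U (fun i e => @?R i e <-> @?S i e) => apply (@definable_equiv U)
    | |- @definable ?U (fun i e => exists x, @?A i e x /\ @?R i e x) => apply (@definable_ex U)
    | |- @definable ?U (fun i e => forall x, @?A i e x -> @?R i e x) => apply (@definable_all U)
    | |- @definable ?U (fun i e => @?R i e -> @?S i e) => apply (@definable_imp U)
    | |- @definable ?U (fun i e => rev_incl _ _) => apply (@definable_rev_incl U)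
    | |- @definable ?U (fun i e => _ ∈ _) => apply (@definable_mem U)
    | |- @definable ?U (fun i e => _ = _) => apply (@definable_eq U)
    | |- @definable_term ?U (fun i e => e _) => apply (@definable_var U)
    | |- @definable_term ?U (fun i e => ⟨_, _⟩) => apply (@definable_opair U)
    | |- @definable_term ?U (fun i e => upair _ _) => apply (@definable_upair U)
    end ]).

(** * The forcing relation for equality *)

Ltac split_and := repeat match goal with |- _ /\ _ => split end.

Section ForcesEq.
Variables (P : V -> Prop) (le : V -> V -> Prop).
Hypothesis le_refl : forall p, le p p.
Hypothesis le_trans : forall p q r, le p q -> le q r -> le p r.

Lemma forces_eq_inv p a b : forces_eq P le p a b ->
  (forall q s c, P q -> le q p -> ⟨s, c⟩ ∈ a -> le q s ->
     exists r t d, P r /\ le r q /\ ⟨t, d⟩ ∈ b /\ le r t /\ forces_eq P le r c d) /\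
  (forall q t d, P q -> le q p -> ⟨t, d⟩ ∈ b -> le q t ->
     exists r s c, P r /\ le r q /\ ⟨s, c⟩ ∈ a /\ le r s /\ forces_eq P le r c d).
Proof. intros H; inversion H; auto. Qed.

Lemma forces_eq_mono p q a b : le q p -> forces_eq P le p a b -> forces_eq P le q a b.
Proof.
  intros Hq H; apply forces_eq_inv in H as [H1 H2].
  constructor; intros; [eapply H1 | eapply H2]; eauto.
Qed.

Lemma forces_eq_refl p a : forces_eq P le p a a.
Proof.
  revert p; induction a as [a IH] using (well_founded_ind in_name_wf); intros p.
  constructor; intros q s c Hq _ Hs Hqs; exists q, s, c; split_and; auto;
    apply IH; now exists s.
Qed.

Lemma forces_eq_sym p a b : forces_eq P le p a b -> forces_eq P le p b a.
Proof.
  revert p b; induction a as [a IH] using (well_founded_ind in_name_wf); intros p b H.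
  apply forces_eq_inv in H as [H1 H2]; constructor.
  - intros q t d Hq Hqp Ht Hqt; destruct (H2 q t d Hq Hqp Ht Hqt) as (r & s & c & ? & ? & ? & ? & ?).
    exists r, s, c; split_and; auto; apply IH; auto; now exists s.
  - intros q s c Hq Hqp Hs Hqs; destruct (H1 q s c Hq Hqp Hs Hqs) as (r & t & d & ? & ? & ? & ? & ?).
    exists r, t, d; split_and; auto; apply IH; auto; now exists s.
Qed.

Lemma forces_eq_trans p a b c :
  forces_eq P le p a b -> forces_eq P le p b c -> forces_eq P le p a c.
Proof.
  revert p b c; induction a as [a IH] using (well_founded_ind in_name_wf); intros p b c H H'.
  apply forces_eq_inv in H as [H1 H2]; apply forces_eq_inv in H' as [H3 H4].
  constructor.
  - intros q s x Hq Hqp Hs Hqs.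
    destruct (H1 q s x Hq Hqp Hs Hqs) as (r & t & y & Hr & Hrq & Ht & Hrt & E1).
    destruct (H3 r t y Hr (le_trans _ _ _ Hrq Hqp) Ht Hrt) as (r' & u & z & Hr' & ? & Hu & ? & E2).
    exists r', u, z; split_and; eauto.
    apply IH with y; [now exists s | apply forces_eq_mono with r; auto | auto].
  - intros q u z Hq Hqp Hu Hqu.
    destruct (H4 q u z Hq Hqp Hu Hqu) as (r & t & y & Hr & Hrq & Ht & Hrt & E1).
    destruct (H2 r t y Hr (le_trans _ _ _ Hrq Hqp) Ht Hrt) as (r' & s & x & Hr' & ? & Hs & ? & E2).
    exists r', s, x; split_and; eauto.
    apply IH with y; [now exists s | auto | apply forces_eq_mono with r; auto].
Qed.

End ForcesEq.

(** * Definability of forced equality inside a class *)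

Section DefinableForcing.
Context {U : family}.
Notation C := (fam_cl U).
Variable P : fam_ix U -> V -> Prop.
Hypothesis P_def : definable (fun i e => P i (e 0)).
Hypothesis P_bound : forall i, exists P0, C i P0 /\ forall p, P i p -> p ∈ P0.
Hypothesis prod_cl : forall i a b, C i a -> C i b ->
  exists c, C i c /\ forall x y, x ∈ a -> y ∈ b -> ⟨x, y⟩ ∈ c.
Hypothesis tc_cl : forall i a, C i a ->
  exists c, C i c /\ a ∈ c /\ forall x y, x ∈ c -> y ∈ x -> y ∈ c.

Lemma P_cl i p : P i p -> C i p.
Proof.
  intros Hp; destruct (P_bound i) as (P0 & H0 & H); apply (fam_trans U i P0 p); auto.
Qed.

(* By well-foundedness a set of triples that satisfies the recursion clause consists of
   true instances of [forces_eq], and every true instance lies in such a set; this defines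
   [forces_eq] inside a class without transfinite recursion. *)
Definition eq_clause (i : fam_ix U) (B p a b : V) : Prop :=
  P i p /\
  (forall q, C i q -> forall s, C i s -> forall c, C i c ->
    P i q -> rev_incl q p -> ⟨s, c⟩ ∈ a -> rev_incl q s ->
     exists r, C i r /\ exists t, C i t /\ exists d, C i d /\
       (P i r /\ rev_incl r q /\ ⟨t, d⟩ ∈ b /\ rev_incl r t /\ ⟨r, ⟨c, d⟩⟩ ∈ B)) /\
  (forall q, C i q -> forall t, C i t -> forall d, C i d ->
    P i q -> rev_incl q p -> ⟨t, d⟩ ∈ b -> rev_incl q t ->
     exists r, C i r /\ exists s, C i s /\ exists c, C i c /\
       (P i r /\ rev_incl r q /\ ⟨s, c⟩ ∈ a /\ rev_incl r s /\ ⟨r, ⟨c, d⟩⟩ ∈ B)).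

Lemma P_def_at n : definable (fun i e => P i (e n)).
Proof. apply (definable_ren _ (fun _ => n) P_def). Qed.

Definition eq_consistent (i : fam_ix U) (B : V) : Prop :=
  forall p, C i p -> forall a, C i a -> forall b, C i b ->
    ⟨p, ⟨a, b⟩⟩ ∈ B -> eq_clause i B p a b.

Lemma eq_consistent_sound i B p a b : C i B ->
  eq_consistent i B -> ⟨p, ⟨a, b⟩⟩ ∈ B -> forces_eq (P i) rev_incl p a b.
Proof.
  intros HB HC; revert p b; induction a as [a IH] using (well_founded_ind in_name_wf).
  intros p b H.
  destruct (opair_mem_cl i _ _ _ HB H) as [Hp Hab]; destruct (opair_cl_inv i _ _ Hab) as [Ha Hb].
  destruct (HC p Hp a Ha b Hb H) as (_ & H1 & H2); constructor.
  - intros q s c Hq Hqp Hs Hqs; destruct (opair_mem_cl i _ _ _ Ha Hs) as [Cs Cc].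
    destruct (H1 q (P_cl i q Hq) s Cs c Cc Hq Hqp Hs Hqs)
      as (r & _ & t & _ & d & _ & Hr & ? & ? & ? & Hcd).
    exists r, t, d; split_and; auto; apply IH; auto; now exists s.
  - intros q t d Hq Hqp Ht Hqt; destruct (opair_mem_cl i _ _ _ Hb Ht) as [Ct Cd].
    destruct (H2 q (P_cl i q Hq) t Ct d Cd Hq Hqp Ht Hqt)
      as (r & _ & s & _ & c & _ & Hr & ? & Hs & ? & Hcd).
    exists r, s, c; split_and; auto; apply IH; auto; now exists s.
Qed.

Definition in_consistent (i : fam_ix U) (z : V) : Prop :=
  exists B, C i B /\ (eq_consistent i B /\ z ∈ B).

Lemma in_consistent_def n : definable (fun i e => in_consistent i (e n)).
Proof.
  unfold in_consistent, eq_consistent, eq_clause; definability; apply P_def_at.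
Qed.

(** Induction on the name [a]. A transitive set [T] containing both names is fixed beforehand, so
    that all triples met by the recursion lie in one set [A] of the class, from which separation can
    select. *)
Lemma forces_eq_in_consistent i p a b : P i p -> C i a -> C i b ->
  forces_eq (P i) rev_incl p a b -> in_consistent i ⟨p, ⟨a, b⟩⟩.
Proof.
  intros Hp Ha Hb.
  destruct (P_bound i) as (P0 & HP0 & HP).
  destruct (tc_cl i (upair a b)) as (T & HT & Tab & Ttr); [now apply fam_upair |].
  destruct (prod_cl i T T HT HT) as (T2 & HT2 & HTT).
  destruct (prod_cl i P0 T2 HP0 HT2) as (A & HA & HPA).
  assert (Tpair : forall x s c, ⟨s, c⟩ ∈ x -> x ∈ T -> c ∈ T).
  { intros x s c Hs Hx; apply (Ttr (upair s c)); [|apply mem_upair; auto].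
    apply (Ttr ⟨s, c⟩); [|apply mem_upair; auto]; eapply Ttr; eauto. }
  assert (Ta : a ∈ T) by (apply (Ttr _ _ Tab), mem_upair; auto).
  assert (Tb : b ∈ T) by (apply (Ttr _ _ Tab), mem_upair; auto).
  clear Tab Ha Hb; revert p b Hp Tb.
  induction a as [a IH] using (well_founded_ind in_name_wf); intros p b Hp Tb H.
  assert (Hz : ⟨p, ⟨a, b⟩⟩ ∈ A) by (apply HPA; auto).
  assert (Cz : C i ⟨p, ⟨a, b⟩⟩) by (apply (fam_trans U i A); auto).
  (* [B] collects all triples over [T] that lie in some consistent set, together with the new
     triple. The union of consistent sets is again consistent, and keeping the names in [T] makes it
     a set. *)
  destruct (definable_sep (fun i z e => (in_consistent i z \/ z = e 0) /\
      exists x, C i x /\ exists y, C i y /\ exists w, C i w /\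
        (z = ⟨x, ⟨y, w⟩⟩ /\ y ∈ e 1 /\ w ∈ e 1)) i
    (scons ⟨p, ⟨a, b⟩⟩ (fun _ => T)) A) as (B & HB & HBA); auto.
  { definability; apply in_consistent_def. }
  { now apply scons_cl. }
  simpl in HBA.
  assert (CT : forall x, x ∈ T -> C i x) by (intros x; now apply fam_trans).
  assert (sub : forall q c d, P i q -> c ∈ T -> d ∈ T ->
    in_consistent i ⟨q, ⟨c, d⟩⟩ \/ ⟨q, ⟨c, d⟩⟩ = ⟨p, ⟨a, b⟩⟩ -> ⟨q, ⟨c, d⟩⟩ ∈ B).
  { intros q c d Hq Hc Hd ?; apply HBA; split; [apply HPA; auto |]; split; auto.
    exists q; split; [now apply P_cl |]; exists c; split; auto; exists d; auto. }
  exists B; split; auto; split; [|apply sub; auto].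
  intros p' Cp a' Ca b' Cb HB'.
  apply HBA in HB' as (_ & Hor & x & _ & y & _ & w & _ & E & Ta' & Tb').
  apply opair_inj in E as [<- E]; apply opair_inj in E as [<- <-].
  (* An old triple keeps the witnesses of its consistent set [B']. For the new triple they come from
     the assumption [H], and the induction hypothesis places them in consistent sets. *)
  destruct Hor as [(B' & HB' & Hcons & HzB) | E].
  - destruct (Hcons p' Cp a' Ca b' Cb HzB) as (Hp' & H1 & H2).
    split; auto; split.
    + intros q Cq s Cs c Cc Hq Hqp Hs Hqs.
      destruct (H1 q Cq s Cs c Cc Hq Hqp Hs Hqs)
        as (r & Cr & t & Ct & d & Cd & Hr & ? & ? & ? & Hcd).
      exists r; split; auto; exists t; split; auto; exists d; split_and; auto.
      apply sub; [auto | eapply Tpair; eassumption .. | left; exists B'; auto].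
    + intros q Cq t Ct d Cd Hq Hqp Ht Hqt.
      destruct (H2 q Cq t Ct d Cd Hq Hqp Ht Hqt)
        as (r & Cr & s & Cs & c & Cc & Hr & ? & ? & ? & Hcd).
      exists r; split; auto; exists s; split; auto; exists c; split_and; auto.
      apply sub; [auto | eapply Tpair; eassumption .. | left; exists B'; auto].
  - apply opair_inj in E as [-> E]; apply opair_inj in E as [-> ->].
    apply forces_eq_inv in H as [H1 H2]; split; auto; split.
    + intros q Cq s Cs c Cc Hq Hqp Hs Hqs.
      destruct (H1 q s c Hq Hqp Hs Hqs) as (r & t & d & Hr & ? & Ht & ? & Hcd).
      destruct (opair_mem_cl i _ _ _ Cb Ht) as [Ct Cd].
      exists r; split; [now apply P_cl |]; exists t; split; auto; exists d; split_and; auto.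
      apply sub; [auto | eapply Tpair; eassumption .. |].
      left; apply IH; [now exists s | eapply Tpair; eassumption | auto | eapply Tpair; eassumption | auto].
    + intros q Cq t Ct d Cd Hq Hqp Ht Hqt.
      destruct (H2 q t d Hq Hqp Ht Hqt) as (r & s & c & Hr & ? & Hs & ? & Hcd).
      destruct (opair_mem_cl i _ _ _ Ca Hs) as [Cs Cc].
      exists r; split; [now apply P_cl |]; exists s; split; auto; exists c; split_and; auto.
      apply sub; [auto | eapply Tpair; eassumption .. |].
      left; apply IH; [now exists s | eapply Tpair; eassumption | auto | eapply Tpair; eassumption | auto].
Qed.

(** Consistent sets contain only triples whose first entry is a condition, hence the conjunct
    [P i (e k)]. It accompanies forced equality in all definitions below. *)
Lemma forces_eq_definable k l m :
  definable (fun i e => P i (e k) /\ forces_eq (P i) rev_incl (e k) (e l) (e m)).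
Proof.
  apply definable_iff with (fun i e => P i (e k) /\ in_consistent i ⟨e k, ⟨e l, e m⟩⟩).
  - intros i e He; split; intros [Hp H]; split; auto.
    + now apply forces_eq_in_consistent.
    + destruct H as (B & HB & Hcons & H); eapply eq_consistent_sound; eauto.
  - apply definable_and; [apply P_def_at |].
    apply (definable_subst (fun i x e => in_consistent i x)); [apply in_consistent_def |].
    definability.
Qed.

End DefinableForcing.

(** * Sets in a transitive model *)

Definition union (x : V) : V := setOf (fun z => exists y, y ∈ x /\ z ∈ y).

Lemma mem_union x z : z ∈ union x <-> exists y, y ∈ x /\ z ∈ y.
Proof.
  apply mem_setOf; destruct (V_sup x) as (A & f & ->).
  (* The union is covered by pairs of indices: one for a member of [x], and one for a branch of the
     tree representing that member. *)
  exists {a : A & match rep (f a) with @Node B _ => B end},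
    (fun u => match u with existT _ a b =>
       cls (match rep (f a) as t return match t with @Node B _ => B end -> tree with
            | @Node _ g => g end b) end).
  intros z' (y & Hy & Hz); apply mem_sup in Hy as [a ->].
  assert (H : exists b, z' = cls (match rep (f a) as t
      return match t with @Node B _ => B end -> tree with @Node _ g => g end b)).
  { unfold mem in Hz; destruct (rep (f a)) as [B g]; destruct Hz as [b Hb].
    exists b; rewrite <- (cls_rep z'); now apply cls_eq. }
  destruct H as [b ->]; now exists (existT _ a b).
Qed.

Definition image (F : V -> V) (x : V) : V := setOf (fun z => exists y, y ∈ x /\ z = F y).

Lemma mem_image F x z : z ∈ image F x <-> exists y, y ∈ x /\ z = F y.
Proof. apply mem_setOf, small_image; intros; congruence. Qed.

Definition cup (x y : V) : V := union (upair x y).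

Lemma mem_cup x y z : z ∈ cup x y <-> z ∈ x \/ z ∈ y.
Proof.
  unfold cup; rewrite mem_union; split.
  - intros (w & Hw & H); apply mem_upair in Hw as [-> | ->]; auto.
  - intros [H | H]; [exists x | exists y]; rewrite mem_upair; auto.
Qed.

Definition omega : V := setOf (fun z => exists n, z = num n).

Lemma mem_omega z : z ∈ omega <-> exists n, z = num n.
Proof. apply mem_setOf; exists nat, num; auto. Qed.

Lemma num_succ n : num (S n) = cup (num n) (upair (num n) (num n)).
Proof.
  apply V_ext; intros z; rewrite mem_cup, mem_upair, !mem_num; split.
  - intros (k & Hk & ->); destruct (Nat.eq_dec k n) as [-> | H]; auto.
    left; exists k; split; [lia | auto].
  - intros [(k & Hk & ->) | [-> | ->]]; eauto with arith.
Qed.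

Section Model.
Variable M : V -> Prop.
Hypothesis hM : ctm M.

Lemma M_trans x y : M x -> y ∈ x -> M y.
Proof. apply (ctm_transitive hM). Qed.

Lemma M_upair x y : M x -> M y -> M (upair x y).
Proof.
  intros Hx Hy; destruct (zfc_pairing (ctm_zfc hM) x y Hx Hy) as (z & Hz & Hxz & Hyz).
  (* Pairing yields only a superset [z] of the pair. Variable 0 is the element of [z], variables 1
     and 2 are [x] and [y]; the formula is a disjunction expressed by negation and conjunction. *)
  destruct (zfc_separation (ctm_zfc hM)
    (fNot (fAnd (fNot (fEq 0 1)) (fNot (fEq 0 2)))) (scons x (fun _ => y)) z) as (b & Hb & H); auto.
  { intros [|n]; simpl; auto. }
  replace (upair x y) with b; auto.
  apply V_ext; intros w; rewrite mem_upair; split.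
  - intros Hw; apply H in Hw as [_ Hw]; simpl in Hw; [tauto |].
    now apply (M_trans b).
  - intros Hw; assert (w ∈ z) by (now destruct Hw as [-> | ->]).
    apply H; [now apply (M_trans z) |]; simpl; tauto.
Qed.

Lemma M_empty : M empty.
Proof.
  destruct (zfc_infinity (ctm_zfc hM)) as (w & _ & (o & Ho & _ & H) & _).
  replace empty with o; auto; apply V_ext; intros z; split; intros Hz; exfalso.
  - apply (H z); auto; now apply (M_trans o).
  - now apply (mem_empty z).
Qed.

Definition model_family : family.
Proof.
  refine {| fam_ix := unit; fam_cl := fun _ => M; fam_const := fun c => M (c tt) |}.
  - intros c Hc []; auto.
  - apply M_empty.
  - intros _; apply M_trans.
  - intros _; apply M_upair.
  - intros _ phi e a He Ha.
    destruct (zfc_separation (ctm_zfc hM) phi e a He Ha) as (b & Hb & H).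
    exists b; split; auto; intros x; split; intros Hx.
    + apply H in Hx; auto; now apply (M_trans b).
    + apply H; auto; now apply (M_trans a).
Defined.

Notation mdef := (@definable model_family).
Notation mterm := (@definable_term model_family).

Lemma M_const a : M a -> mterm (fun _ _ => a).
Proof. intros Ha; apply (definable_const (U := model_family) (fun _ => a) Ha). Qed.

Lemma M_union x : M x -> M (union x).
Proof.
  intros Hx; destruct (zfc_union (ctm_zfc hM) x Hx) as (u & Hu & H).
  destruct (definable_sep (U := model_family)
    (fun _ z e => exists y, M y /\ (y ∈ e 0 /\ z ∈ y)) tt (fun _ => x) u) as (b & Hb & Hbu); auto.
  { definability. }
  replace (union x) with b; auto; apply V_ext; intros z; rewrite Hbu, mem_union; split.
  - intros (_ & y & _ & Hy); eauto.
  - intros (y & Hy & Hz); assert (M y) by now apply (M_trans x).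
    split; [|eauto]; apply (H y); auto; now apply (M_trans y).
Qed.

Lemma M_cup x y : M x -> M y -> M (cup x y).
Proof. intros; now apply M_union, M_upair. Qed.

Lemma definable_union t : mterm t -> mterm (fun i e => union (t i e)).
Proof.
  intros Ht; apply definable_term_intro with (fun i z e => exists y, M y /\ (y ∈ t i e /\ z ∈ y)).
  - intros i e He; apply M_union, Ht, He.
  - intros i e x He Hx; rewrite mem_union; split; intros (y & H); exists y; [|tauto].
    split; auto; apply (M_trans (t i e)); [apply Ht, He | tauto].
  - apply (definable_ex (U := model_family)); definability.
    now apply (definable_term_ren _ (fun n => S (S n))).
Qed.

Lemma definable_cup t u : mterm t -> mterm u -> mterm (fun i e => cup (t i e) (u i e)).
Proof. intros; now apply definable_union, definable_upair. Qed.

(** ** Replacement *)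

Lemma M_replacement (R : V -> V -> (nat -> V) -> Prop) e a :
  mdef (fun _ e => R (e 0) (e 1) (fun n => e (S (S n)))) -> (forall n, M (e n)) -> M a ->
  (forall x, x ∈ a -> exists! y, M y /\ R y x e) ->
  exists b, M b /\ forall y, y ∈ b <-> exists x, x ∈ a /\ M y /\ R y x e.
Proof.
  intros HR He Ha Hex; destruct HR as (phi & c & Hc & Hphi).
  (* In the axiom the value and the argument occupy positions 0 and 1, and the interleaved sequence
     of remaining variables and parameters starts at position 2. *)
  set (rho := mix (fun k => match k with 0 => 0 | 1 => 1 | S (S k) => S (S (2 * k)) end)
    (fun k => S (S (S (2 * k))))).
  assert (E : forall y x, M y -> M x ->
    (sat M (scons y (scons x (mix e (fun n => c n tt)))) (ren rho phi) <-> R y x e)).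
  { intros y x Hy Hx; unfold rho; rewrite sat_ren, mix_comp.
    rewrite <- (Hphi tt (scons y (scons x e)));
      [|apply (scons_cl (U := model_family) tt), (scons_cl (U := model_family) tt); auto].
    match goal with |- sat _ ?a _ <-> sat _ ?b _ => replace a with b; [reflexivity |] end.
    f_equal; extensionality k.
    - destruct k as [|[|k]]; cbn -[Nat.mul]; auto; now rewrite mix_even.
    - change (c k tt = mix e (fun n => c n tt) (S (2 * k))); now rewrite mix_odd. }
  destruct (zfc_replacement (ctm_zfc hM) (ren rho phi) (mix e (fun n => c n tt)) a)
    as (b & Hb & H); auto.
  { intros n; unfold mix; destruct (parity n); auto; apply Hc. }
  { intros x Hx Hxa; destruct (Hex x Hxa) as (y & [Hy HR] & Hu); exists y; split.
    - split; auto; now apply E.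
    - intros y' [Hy' H']; apply Hu; split; auto; now apply (E y' x). }
  (* The axiom only collects the values in a set [b], possibly with other elements; separation cuts
     it down to the image. *)
  destruct (definable_sep (U := model_family) (fun _ y e' => exists x, M x /\
     (x ∈ e' 0 /\ R y x (fun n => e' (S n)))) tt (scons a e) b) as (d & Hd & Hdb); auto.
  { apply (definable_ex (U := model_family)), definable_and; [definability |].
    apply (definable_ren (U := model_family) (fun _ e => R (e 0) (e 1) (fun n => e (S (S n))))
      (fun n => match n with 0 => 1 | 1 => 0 | S (S n) => S (S (S n)) end)).
    exists phi, c; auto. }
  { now apply (scons_cl (U := model_family) tt). }
  exists d; split; auto; intros y; rewrite Hdb; simpl; split.
  - intros (Hy & x & Hx & Hxa & HR); exists x; split_and; auto; now apply (M_trans b).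
  - intros (x & Hxa & Hy & HR).
    assert (Hx : M x) by now apply (M_trans a).
    split; [|exists x; auto].
    destruct (H x Hx Hxa) as (y' & Hy' & Hyb & HR').
    apply E in HR'; auto.
    destruct (Hex x Hxa) as (w & _ & Hu).
    rewrite <- (Hu y), (Hu y'); auto.
Qed.

Lemma M_image (F : V -> (nat -> V) -> V) e a :
  mterm (fun _ e => F (e 0) (fun n => e (S n))) -> (forall n, M (e n)) -> M a ->
  M (image (fun x => F x e) a).
Proof.
  intros [HF1 HF2] He Ha.
  destruct (M_replacement (fun y x e => y = F x e) e a) as (b & Hb & H); auto.
  - intros x Hx; exists (F x e); split; [|intros y [_ ->]; auto].
    split; auto; apply (HF1 tt (scons x e)), (scons_cl (U := model_family) tt); auto.
    now apply (M_trans a).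
  - replace (image (fun x => F x e) a) with b; auto.
    apply V_ext; intros z; rewrite H, mem_image; split.
    + intros (x & Hx & _ & ->); eauto.
    + intros (x & Hx & ->); exists x; repeat split; auto.
      apply (HF1 tt (scons x e)), (scons_cl (U := model_family) tt); auto.
      now apply (M_trans a).
Qed.

Lemma definable_image t (F : unit -> V -> (nat -> V) -> V) : mterm t ->
  mterm (fun i e => F i (e 0) (fun n => e (S n))) ->
  mterm (fun i e => image (fun x => F i x e) (t i e)).
Proof.
  intros Ht HF.
  apply definable_term_intro with (fun i z e => exists y, M y /\ (y ∈ t i e /\ z = F i y e)).
  - intros [] e He; apply (M_image (F tt)); auto; [|apply Ht, He].
    replace (fun (_ : fam_ix model_family) e => F tt (e 0) (fun n => e (S n)))
      with (fun i e => F i (e 0) (fun n : nat => e (S n))); auto.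
    now extensionality i; destruct i.
  - intros i e x He Hx; rewrite mem_image; split; intros (y & H); exists y; [|tauto].
    split; auto; apply (M_trans (t i e)); [apply Ht, He | tauto].
  - apply (definable_ex (U := model_family)); definability.
    + now apply (definable_term_ren _ (fun n => S (S n))).
    + apply (definable_term_ren _ (fun n => match n with 0 => 0 | S n => S (S n) end)) in HF.
      exact HF.
Qed.

End Model.

Arguments model_family {M} hM.
Arguments M_trans {M} hM.
Arguments M_upair {M} hM.
Arguments M_empty {M} hM.
Arguments M_const {M} hM.
Arguments M_union {M} hM.
Arguments M_cup {M} hM.
Arguments definable_image {M} hM.
Arguments M_image {M} hM.
Arguments M_replacement {M} hM.

Notation mdefinable hM := (@definable (model_family hM)).
Notation mterm hM := (@definable_term (model_family hM)).

Ltac model_definability :=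
  repeat (definability; first [ assumption | match goal with
    | |- definable_term (fun i e => union _) => apply definable_union
    | |- definable_term (fun i e => cup _ _) => apply definable_cup
    | |- definable_term (fun i e => image _ _) => apply definable_image
    | |- definable_term (fun i e => _) => apply M_const; assumption
    end ]).

Definition range (G : nat -> V) : V := setOf (fun z => exists n, z = G n).

Lemma mem_range G z : z ∈ range G <-> exists n, z = G n.
Proof. apply mem_setOf; exists nat, G; auto. Qed.

Section Recursion.
Variable M : V -> Prop.
Hypothesis hM : ctm M.

Definition succ (x : V) : V := cup x (upair x x).

Lemma mem_succ x z : z ∈ succ x <-> z ∈ x \/ z = x.
Proof. unfold succ; rewrite mem_cup, mem_upair; tauto. Qed.

Lemma succ_num n : succ (num n) = num (S n).
Proof. now rewrite num_succ. Qed.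

Lemma succ_num_inj x n : succ x = num (S n) -> x = num n.
Proof.
  intros E.
  assert (Hx : x ∈ num (S n)) by (rewrite <- E; apply mem_succ; auto).
  apply mem_num in Hx as (k & Hk & ->).
  rewrite succ_num in E; apply num_inj in E; f_equal; lia.
Qed.

Lemma M_succ x : M x -> M (succ x).
Proof. intros; unfold succ; apply (M_cup hM); auto; now apply (M_upair hM). Qed.

Lemma M_num n : M (num n).
Proof.
  induction n as [|n IH]; [now apply (M_empty hM) |].
  rewrite <- succ_num; now apply M_succ.
Qed.

Lemma definable_succ t : mterm hM t -> mterm hM (fun i e => succ (t i e)).
Proof. intros Ht; unfold succ; model_definability. Qed.

(** Infinity gives some inductive set [w]. Let [b] be the part of [w] common to all inductive sets
    of the model. An element of [b] that is ∈-minimal among the non-numerals could be removed from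
    [b] without destroying inductiveness, so [b] is ω. *)
Lemma M_omega : M omega.
Proof.
  destruct (zfc_infinity (ctm_zfc hM)) as (w & Hw & (o & Ho & How & Hempty) & Hsucc).
  assert (Ew : empty ∈ w).
  { replace empty with o; auto; apply V_ext; intros z; split; intros Hz; exfalso.
    - apply (Hempty z); auto; now apply (M_trans hM o).
    - now apply (mem_empty z). }
  assert (Sw : forall x, x ∈ w -> succ x ∈ w).
  { intros x Hx; assert (Mx : M x) by now apply (M_trans hM w).
    destruct (Hsucc x Mx Hx) as (s & Hs & Hsw & H).
    replace (succ x) with s; auto; apply V_ext; intros z; rewrite mem_succ; split.
    - intros Hz; apply H in Hz; [tauto | now apply (M_trans hM s)].
    - intros Hz; apply H; [|tauto].
      destruct Hz as [Hz | ->]; [now apply (M_trans hM x) | auto]. }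
  assert (Nw : forall n, num n ∈ w).
  { induction n as [|n IH]; auto; rewrite <- succ_num; auto. }
  assert (M0 : M empty) by now apply (M_empty hM).
  destruct (definable_sep (U := model_family hM) (fun _ z _ => forall v, M v ->
     empty ∈ v -> (forall x, M x -> x ∈ v -> succ x ∈ v) -> z ∈ v) tt (fun _ => w) w)
    as (b & Hb & H); auto.
  { definability; [apply M_const; auto | apply definable_succ; definability]. }
  replace omega with b; auto; apply V_ext; intros z; rewrite mem_omega, H; split.
  - intros [Hz Hall]; induction z as [z IH] using (well_founded_ind mem_wf).
    apply NNPP; intros Hnum.
    destruct (definable_sep (U := model_family hM) (fun _ x e => x <> e 0)
      tt (fun _ => z) b) as (b' & Hb' & H'); auto.
    { definability. }
    { intros; now apply (M_trans hM w). }
    assert (Hzb : z ∈ b') by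
      (apply Hall; auto; [apply H'; split |]; [apply H; split; auto | | ];
      [intros <-; apply Hnum; now exists 0 |];
      intros x _ Hx; apply H' in Hx as [Hx Hxz]; apply H'; split;
      [ apply H; apply H in Hx as [Hx Hx']; split; auto;
        intros v Hv He Hs; apply Hs; [now apply (M_trans hM w) | auto]
      | intros Ez; destruct (IH x) as [n Hn];
        [ rewrite <- Ez; apply mem_succ; auto
        | now apply H in Hx | intros v Hv; apply H in Hx; now apply Hx
        | apply Hnum; exists (S n); now rewrite <- Ez, Hn, succ_num ] ]).
    apply H' in Hzb as [_ Hzb]; now apply Hzb.
  - intros [n ->]; split; auto; intros v Hv He Hs.
    induction n as [|n IH]; auto; rewrite <- succ_num; apply Hs; auto; apply M_num.
Qed.

(** ** Iteration along ω *)

Section Iteration.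
Variable F : V -> V.
Hypothesis F_def : mterm hM (fun _ e => F (e 0)).
Variable a : V.
Hypothesis Ma : M a.

Lemma M_F x : M x -> M (F x).
Proof. intros Hx; apply (proj1 F_def tt (fun _ => x)); auto. Qed.

Lemma M_iter n : M (Nat.iter n F a).
Proof. induction n; simpl; auto; now apply M_F. Qed.

(** [B] need not be a function on an initial segment. It is enough that each of its pairs is the
    starting pair or comes from another pair of [B] by one step; induction on the first entry then
    determines the second. *)
Definition in_iteration (x y : V) : Prop :=
  exists B, M B /\ (⟨x, y⟩ ∈ B /\
    forall u, M u -> forall v, M v -> ⟨u, v⟩ ∈ B ->
      (u = empty /\ v = a) \/
      (exists k, M k /\ exists w, M w /\ (⟨k, w⟩ ∈ B /\ u = succ k /\ v = F w))).

Lemma in_iteration_iff n y : in_iteration (num n) y <-> y = Nat.iter n F a.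
Proof.
  split.
  - revert y; induction n as [|n IH]; intros y (B & HB & Hy & H);
      destruct (opair_mem_cl (U := model_family hM) tt _ _ _ HB Hy) as [H1 H2];
      destruct (H _ H1 _ H2 Hy) as [[E1 E2] | (k & _ & w & _ & Hkw & E1 & E2)]; auto.
    + exfalso; apply (mem_empty k); change (k ∈ num 0); rewrite E1; apply mem_succ; auto.
    + exfalso; change empty with (num 0) in E1; now apply num_inj in E1.
    + symmetry in E1; apply succ_num_inj in E1 as ->; simpl; rewrite E2; f_equal.
      apply IH; exists B; auto.
  - intros ->; induction n as [|n (B & HB & Hn & H)].
    + exists (upair ⟨empty, a⟩ ⟨empty, a⟩).
      assert (M empty) by now apply (M_empty hM).
      split; [|split; [apply mem_upair; auto |]].
      * assert (M ⟨empty, a⟩) by now apply (opair_cl (U := model_family hM) tt).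
        now apply (M_upair hM).
      * intros u _ v _ Huv; left; apply mem_upair in Huv.
        destruct Huv as [E | E]; now apply opair_inj in E.
    + set (z := ⟨num (S n), Nat.iter (S n) F a⟩).
      assert (M z) by (apply (opair_cl (U := model_family hM) tt); [apply M_num | apply M_iter]).
      exists (cup B (upair z z)); split; [apply (M_cup hM); auto; now apply (M_upair hM) |].
      split; [apply mem_cup; right; apply mem_upair; auto |].
      intros u Mu v Mv Huv; apply mem_cup in Huv as [Huv | Huv].
      * destruct (H u Mu v Mv Huv) as [E | (k & Mk & w & Mw & Hkw & E)]; auto.
        right; exists k; split; auto; exists w; split_and; try tauto; apply mem_cup; auto.
      * right; exists (num n); split; [apply M_num |].
        exists (Nat.iter n F a); split; [apply M_iter |].
        assert (E : ⟨u, v⟩ = z) by (apply mem_upair in Huv; tauto).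
        apply opair_inj in E as [-> ->]; split_and; auto.
        -- apply mem_cup; auto.
        -- now rewrite succ_num.
Qed.

Lemma in_iteration_def (k l : nat) : mdefinable hM (fun _ e => in_iteration (e k) (e l)).
Proof.
  pose proof (M_const hM a Ma) as Ha; pose proof (M_const hM _ (M_empty hM)) as H0.
  unfold in_iteration; definability.
  apply definable_succ; definability.
Qed.

(** [H] receives both the index and the iterate because an entry of a name combines a condition
    depending on the index with a name obtained by iteration. *)
Lemma definable_range (H : V -> V -> (nat -> V) -> V) :
  mterm hM (fun _ e => H (e 0) (e 1) (fun n => e (S (S n)))) ->
  mterm hM (fun _ e => range (fun n => H (num n) (Nat.iter n F a) e)).
Proof.
  intros HH; pose proof (M_const hM omega M_omega) as Hom.
  apply definable_term_intro with (fun _ z e => exists x, M x /\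
    exists y, M y /\ (x ∈ omega /\ in_iteration x y /\ z = H x y e)).
  - intros i e He.
    assert (MH : forall n, M (H (num n) (Nat.iter n F a) e)).
    { intros n; apply (proj1 HH tt (scons (num n) (scons (Nat.iter n F a) e))).
      intros [|[|k]]; [apply M_num | apply M_iter | apply He]. }
    destruct (M_replacement hM (fun z x e => exists y, M y /\ (in_iteration x y /\ z = H x y e))
      e omega) as (b & Hb & Hbm); auto.
    + definability; [apply in_iteration_def |].
      apply (definable_term_ren _ (fun n => match n with 0 => 2 | 1 => 0 | n => S n end)) in HH.
      exact HH.
    + apply M_omega.
    + intros x Hx; apply mem_omega in Hx as [n ->].
      exists (H (num n) (Nat.iter n F a) e); split.
      * split; auto; exists (Nat.iter n F a); split; [apply M_iter |]; split; auto.
        now apply in_iteration_iff.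
      * intros z (_ & y & _ & Hy & ->); apply in_iteration_iff in Hy as ->; auto.
    + replace (range _) with b; auto; apply V_ext; intros z; rewrite Hbm, mem_range; split.
      * intros (x & Hx & _ & y & _ & Hy & ->); apply mem_omega in Hx as [n ->].
        apply in_iteration_iff in Hy as ->; eauto.
      * intros [n ->]; exists (num n); split_and; auto; [apply mem_omega; eauto |].
        exists (Nat.iter n F a); split; [apply M_iter |]; split; auto; now apply in_iteration_iff.
  - intros i e z He _; rewrite mem_range; split.
    + intros [n ->]; exists (num n); split; [apply M_num |].
      exists (Nat.iter n F a); split; [apply M_iter |]; split_and; auto.
      * apply mem_omega; eauto.
      * now apply in_iteration_iff.
    + intros (x & _ & y & _ & Hx & Hy & ->); apply mem_omega in Hx as [n ->].
      apply in_iteration_iff in Hy as ->; eauto.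
  - definability; [apply in_iteration_def |].
    apply (definable_term_ren _ (fun n => match n with 0 => 1 | 1 => 0 | n => S n end)) in HH.
    exact HH.
Qed.

Lemma M_iterates : M (range (fun n => Nat.iter n F a)).
Proof.
  apply (proj1 (definable_range (fun x y _ => y) (definable_var 1)) tt (fun _ => empty)).
  intros _; apply (M_empty hM).
Qed.

End Iteration.

Lemma M_transitive_superset a : M a ->
  exists c, M c /\ a ∈ c /\ forall x y, x ∈ c -> y ∈ x -> y ∈ c.
Proof.
  intros Ma; exists (union (range (fun n => Nat.iter n (fun u => cup u (union u)) (upair a a)))).
  split_and.
  - apply (M_union hM), M_iterates; [model_definability | now apply (M_upair hM)].
  - apply mem_union; exists (upair a a); rewrite mem_range, mem_upair; split; auto; now exists 0.
  - intros x y Hx Hy; apply mem_union in Hx as (u & Hu & Hx); apply mem_range in Hu as [n ->].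
    apply mem_union; exists (Nat.iter (S n) (fun u => cup u (union u)) (upair a a)).
    rewrite mem_range; split; eauto; simpl; apply mem_cup; right; apply mem_union; eauto.
Qed.

Definition product (a b : V) : V := union (image (fun x => image (fun y => ⟨x, y⟩) b) a).

Lemma mem_product a b z : z ∈ product a b <-> exists x y, x ∈ a /\ y ∈ b /\ z = ⟨x, y⟩.
Proof.
  unfold product; rewrite mem_union; split.
  - intros (w & Hw & Hz); apply mem_image in Hw as (x & Hx & ->).
    apply mem_image in Hz as (y & Hy & ->); eauto.
  - intros (x & y & Hx & Hy & ->); exists (image (fun y => ⟨x, y⟩) b).
    split; apply mem_image; eauto.
Qed.

Lemma definable_product t u : mterm hM t -> mterm hM u ->
  mterm hM (fun i e => product (t i e) (u i e)).
Proof.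
  intros Ht Hu; unfold product; model_definability.
  now apply (definable_term_ren _ S).
Qed.

Lemma M_product a b : M a -> M b -> M (product a b).
Proof.
  intros Ha Hb; apply (proj1 (definable_product _ _ (M_const hM a Ha) (M_const hM b Hb))
    tt (fun _ => empty)); intros _; apply (M_empty hM).
Qed.

(** ** Finite subsets *)

(** The n-th iterate starting from {∅} consists of the subsets of [y] with at most n elements. In
    this way the finite subsets of [y] become a set of the model, although [finite] is not given by
    a formula. *)
Definition add_element (y u : V) : V :=
  cup u (union (image (fun y => image (fun p => cup p (upair y y)) u) y)).

Definition finite_subsets (y : V) : V :=
  union (range (fun n => Nat.iter n (add_element y) (upair empty empty))).

Lemma M_finite_subsets y : M y -> M (finite_subsets y).
Proof.
  intros Hy; apply (M_union hM), M_iterates.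
  - pose proof (M_const hM y Hy); unfold add_element; model_definability.
  - apply (M_upair hM); apply (M_empty hM).
Qed.

Lemma finite_add (x y : V) : finite x -> finite (cup x (upair y y)).
Proof.
  intros [l Hl]; exists (y :: l); intros z Hz; apply mem_cup in Hz as [Hz | Hz]; simpl; auto.
  apply mem_upair in Hz; left; symmetry; tauto.
Qed.

Lemma finite_cup_ind (Q : V -> Prop) : Q empty ->
  (forall x y, finite x -> Q x -> Q (cup x (upair y y))) -> forall x, finite x -> Q x.
Proof.
  intros Q0 QS.
  assert (H : forall l x, (forall z, z ∈ x -> In z l) -> Q x).
  { induction l as [|y l IH]; intros x Hx.
    - replace x with empty; auto; apply V_ext; intros z; split; intros Hz.
      + now apply mem_empty in Hz.
      + destruct (Hx z Hz).
    - set (x' := setOf (fun z => z ∈ x /\ z <> y)).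
      assert (Hx' : forall z, z ∈ x' <-> z ∈ x /\ z <> y).
      { intros z; apply mem_setOf; destruct (V_sup x) as (A & f & ->).
        exists A, f; intros w [Hw _]; now apply mem_sup in Hw. }
      assert (Hl : forall z, z ∈ x' -> In z l).
      { intros z Hz; apply Hx' in Hz as [Hz Hne]; destruct (Hx z Hz); [congruence | auto]. }
      destruct (classic (y ∈ x)) as [Hy | Hy].
      + replace x with (cup x' (upair y y)); [apply QS; [now exists l | auto] |].
        apply V_ext; intros z; rewrite mem_cup, mem_upair, Hx'.
        destruct (classic (z = y)) as [-> |]; tauto.
      + apply IH; intros z Hz; destruct (Hx z Hz) as [-> | H]; [contradiction | exact H]. }
  intros x [l Hl]; eauto.
Qed.

Lemma mem_finite_subsets y u : u ∈ finite_subsets y <-> finite u /\ forall z, z ∈ u -> z ∈ y.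
Proof.
  unfold finite_subsets; rewrite mem_union; split.
  - intros (w & Hw & Hu); apply mem_range in Hw as [n ->]; revert u Hu.
    induction n as [|n IH]; simpl; intros u Hu.
    + apply mem_upair in Hu; assert (u = empty) as -> by tauto.
      split; [exists nil |]; intros z Hz; now apply mem_empty in Hz.
    + apply mem_cup in Hu as [Hu | Hu]; auto.
      apply mem_union in Hu as (w & Hw & Hu); apply mem_image in Hw as (x & Hx & ->).
      apply mem_image in Hu as (p & Hp & ->); destruct (IH p Hp) as [H1 H2].
      split; [now apply finite_add |].
      intros z Hz; apply mem_cup in Hz as [Hz | Hz]; auto.
      apply mem_upair in Hz; assert (z = x) as -> by tauto; auto.
  - intros [Hf Hs]; revert Hs; pattern u; apply finite_cup_ind; auto.
    + intros _; exists (upair empty empty); rewrite mem_range, mem_upair; split; auto; now exists 0.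
    + intros p x _ IH Hs; destruct IH as (w & Hw & Hp).
      { intros z Hz; apply Hs, mem_cup; auto. }
      apply mem_range in Hw as [n ->].
      exists (Nat.iter (S n) (add_element y) (upair empty empty)); rewrite mem_range; split; eauto.
      simpl; apply mem_cup; right; apply mem_union.
      exists (image (fun p => cup p (upair x x)) (Nat.iter n (add_element y) (upair empty empty))).
      rewrite !mem_image; split; [exists x; split; auto | eauto].
      apply Hs, mem_cup; right; apply mem_upair; auto.
Qed.

Lemma M_finite x : finite x -> (forall z, z ∈ x -> M z) -> M x.
Proof.
  intros Hf; pattern x; apply finite_cup_ind; auto.
  - intros _; apply (M_empty hM).
  - intros p y _ IH H; apply (M_cup hM).
    + apply IH; intros z Hz; apply H, mem_cup; auto.
    + assert (M y) by (apply H, mem_cup; right; apply mem_upair; auto); now apply (M_upair hM).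
Qed.

End Recursion.

(** * The forcing theorem for Cohen forcing *)

Lemma rev_incl_refl p : rev_incl p p.
Proof. intros z; auto. Qed.

Lemma rev_incl_trans p q r : rev_incl p q -> rev_incl q r -> rev_incl p r.
Proof. unfold rev_incl; auto. Qed.

Section Forcing.
Variable M : V -> Prop.
Hypothesis hM : ctm M.
Notation P := (Fn M).
Notation eqf := (forces_eq (Fn M) rev_incl).

Lemma Fn_subset q s : P q -> M s -> rev_incl q s -> P s.
Proof.
  intros (Hq & [l Hl] & H1 & H2) Hs Hqs; unfold Fn; split_and; auto.
  - exists l; auto.
  - intros u v w Hv Hw; apply (H2 u); auto.
Qed.

Lemma Fn_is_set : exists P0, M P0 /\ forall p, p ∈ P0 <-> P p.
Proof.
  set (Y := product (product omega omega) (num 2)).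
  assert (HY : M Y) by
    (repeat apply (M_product M hM); first [apply M_omega; exact hM | apply M_num; exact hM]).
  destruct (definable_sep (U := model_family hM) (fun _ p _ => forall u, M u ->
     forall v, M v -> forall w, M w -> ⟨u, v⟩ ∈ p -> ⟨u, w⟩ ∈ p -> v = w) tt (fun _ => Y)
     (finite_subsets Y)) as (b & Hb & H); auto.
  { definability. }
  { now apply M_finite_subsets. }
  exists b; split; auto; intros p; rewrite H, mem_finite_subsets; split.
  - intros [[Hf Hs] Hfun].
    assert (Mp : M p) by (apply (M_finite M hM); auto; intros z Hz; apply (M_trans hM Y); auto).
    unfold Fn; split_and; auto.
    + intros z Hz; apply Hs, mem_product in Hz as (u & v & Hu & Hv & ->).
      apply mem_product in Hu as (x & y & Hx & Hy & ->).
      apply mem_omega in Hx as [i ->]; apply mem_omega in Hy as [j ->].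
      apply mem_num in Hv as (k & Hk & ->); eauto 6.
    + intros u v w Hv Hw.
      destruct (opair_mem_cl (U := model_family hM) tt _ _ _ Mp Hv) as [Mu Mv].
      destruct (opair_mem_cl (U := model_family hM) tt _ _ _ Mp Hw) as [_ Mw].
      apply (Hfun u Mu v Mv w Mw); auto.
  - intros (Mp & Hf & Hs & Hfun); split; [split; auto |].
    + intros z Hz; destruct (Hs z Hz) as (i & j & k & Hk & ->).
      apply mem_product; exists ⟨num i, num j⟩, (num k); split_and; auto.
      * apply mem_product; exists (num i), (num j); split_and; auto; apply mem_omega; eauto.
      * apply mem_num; eauto.
    + intros u _ v _ w _; apply Hfun.
Qed.

Lemma Fn_definable n : mdefinable hM (fun _ e => P (e n)).
Proof.
  destruct Fn_is_set as (P0 & H0 & H); pose proof (M_const hM P0 H0).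
  apply definable_iff with (fun _ e => e n ∈ P0); [intros; symmetry; apply H | definability].
Qed.

Lemma eqf_definable k l m : mdefinable hM (fun _ e => P (e k) /\ eqf (e k) (e l) (e m)).
Proof.
  destruct Fn_is_set as (P0 & H0 & H).
  apply (forces_eq_definable (U := model_family hM) (fun _ => P)).
  - apply Fn_definable.
  - intros i; exists P0; split; auto; intros p; apply H.
  - intros i a b Ha Hb; exists (product a b); split; [now apply M_product |].
    intros x y Hx Hy; apply mem_product; eauto.
  - intros i; apply (M_transitive_superset M hM).
Qed.

#[local] Hint Resolve Fn_definable eqf_definable : definability.

(** Every set of the model serves as a name here, so that [is_name] need not be
    definable in the model. *)
Fixpoint frc (p : V) (e : nat -> V) (phi : form) : Prop :=
  match phi with
  | fMem i j => exists t, M t /\ exists d, M d /\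
      (⟨t, d⟩ ∈ e j /\ rev_incl p t /\ (P p /\ eqf p (e i) d))
  | fEq i j => eqf p (e i) (e j)
  | fNot phi => forall q, M q -> P q -> rev_incl q p -> ~ (P q /\ frc q e phi)
  | fAnd phi psi => frc p e phi /\ frc p e psi
  | fEx phi => exists t, M t /\ (P p /\ frc p (scons t e) phi)
  end.

(** One formula per [phi], by recursion on [phi]: the quantifier clause moves the condition from
    variable 0 to variable 1 and the new name into its place. *)
Lemma frc_definable phi : mdefinable hM (fun _ e => P (e 0) /\ frc (e 0) (fun n => e (S n)) phi).
Proof.
  induction phi as [i j | i j | phi IH | phi IH1 psi IH2 | phi IH]; simpl.
  - definability.
  - apply eqf_definable.
  - apply definable_and; [apply Fn_definable |].
    apply (definable_all (U := model_family hM)), definable_imp; [apply Fn_definable |].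
    apply definable_imp; [definability | apply definable_not].
    apply (definable_ren _ (fun n => match n with 0 => 0 | S n => S (S n) end)) in IH; exact IH.
  - eapply definable_iff; [| apply definable_and; [apply IH1 | apply IH2]].
    intros; simpl; tauto.
  - apply definable_and; [apply Fn_definable |]; apply (definable_ex (U := model_family hM)).
    apply (definable_ren _ (fun n => match n with 0 => 1 | 1 => 0 | S n => S n end)) in IH.
    eapply definable_iff; [| exact IH]; intros i e _; simpl.
    replace (scons (e 0) (fun n => e (S (S n)))) with
      (fun n => e (match n with 0 => 0 | S _ => S n end)); [reflexivity |].
    extensionality n; now destruct n.
Qed.

Lemma frc_definable_at phi k (f : nat -> nat) :
  mdefinable hM (fun _ e => P (e k) /\ frc (e k) (fun n => e (f n)) phi).
Proof.
  pose proof (frc_definable phi) as H.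
  apply (definable_ren _ (fun n => match n with 0 => k | S n => f n end)) in H; exact H.
Qed.

#[local] Hint Resolve frc_definable_at : definability.

Lemma frc_mono phi : forall p q e, P q -> rev_incl q p -> frc p e phi -> frc q e phi.
Proof.
  induction phi as [i j | i j | phi IH | phi IH1 psi IH2 | phi IH]; simpl; intros p q e Hq Hqp H.
  - destruct H as (t & Ht & d & Hd & Htd & Hpt & _ & H).
    exists t; split; auto; exists d; split_and; auto; [eapply rev_incl_trans; eauto |].
    eapply forces_eq_mono; eauto; apply rev_incl_trans.
  - eapply forces_eq_mono; eauto; apply rev_incl_trans.
  - intros r Mr Hr Hrq; apply H; auto; eapply rev_incl_trans; eauto.
  - destruct H; eauto.
  - destruct H as (t & Ht & _ & H); exists t; split_and; eauto.
Qed.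

(** ** Generic filters *)

Section Generic.
Variable G : V -> Prop.
Hypothesis hG : generic M P rev_incl G.

Lemma generic_Fn p : G p -> P p.
Proof. apply hG. Qed.

Lemma generic_M p : G p -> M p.
Proof. intros Hp; now apply generic_Fn in Hp as [? _]. Qed.

Lemma generic_common p q : G p -> G q -> exists r, G r /\ rev_incl r p /\ rev_incl r q.
Proof. apply hG. Qed.

Lemma generic_up p s : G p -> M s -> rev_incl p s -> G s.
Proof.
  intros Hp Hs Hps; destruct hG as (_ & _ & H & _); apply (H p); auto.
  apply (Fn_subset p); auto; now apply generic_Fn.
Qed.

Lemma generic_empty : G empty.
Proof.
  destruct hG as (_ & [p Hp] & _); apply (generic_up p); auto; [apply (M_empty hM) |].
  intros z Hz; now apply mem_empty in Hz.
Qed.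

(** Genericity is about sets that are dense everywhere. A set dense below [q] becomes dense when the
    conditions incompatible with [q] are added, and none of these can lie in a filter containing
    [q]. *)
Lemma generic_meets (R : V -> (nat -> V) -> Prop) e q :
  mdefinable hM (fun _ e => R (e 0) (fun n => e (S n))) -> (forall n, M (e n)) -> G q ->
  (forall p, P p -> rev_incl p q -> exists r, P r /\ rev_incl r p /\ R r e) ->
  exists r, G r /\ rev_incl r q /\ R r e.
Proof.
  intros HR He Hq Hdense.
  destruct Fn_is_set as (P0 & H0 & HP0).
  destruct (definable_sep (U := model_family hM) (fun _ r e =>
      (R r (fun n => e (S n)) /\ rev_incl r (e 0)) \/
      (forall x, M x -> P x -> ~ (rev_incl x r /\ rev_incl x (e 0)))) tt (scons q e) P0)
    as (D & HD & HDP); auto.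
  { definability.
    apply (definable_ren _ (fun n => match n with 0 => 0 | S n => S (S n) end)) in HR; exact HR. }
  { apply (scons_cl (U := model_family hM) tt); auto; now apply generic_M. }
  simpl in HDP.
  destruct hG as (_ & _ & _ & _ & Hmeet); destruct (Hmeet D) as (r & HrD & Hr); auto.
  - intros d Hd; apply HDP in Hd as [Hd _]; now apply HP0.
  - intros p Hp.
    destruct (classic (exists x, P x /\ rev_incl x p /\ rev_incl x q)) as [(x & Hx & Hxp & Hxq) | Hno].
    + destruct (Hdense x Hx Hxq) as (r & Hr & Hrx & HRr).
      exists r; split; [|eapply rev_incl_trans; eauto].
      apply HDP; split; [now apply HP0 |]; left; split; auto; eapply rev_incl_trans; eauto.
    + exists p; split; [|apply rev_incl_refl]; apply HDP; split; [now apply HP0 |].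
      right; intros x _ Hx H; apply Hno; exists x; tauto.
  - apply HDP in HrD as [_ [[HRr Hrq] | Hno]]; [exists r; auto |].
    destruct (generic_common r q Hr Hq) as (x & Hx & Hxr & Hxq); exfalso.
    apply (Hno x); auto; [now apply generic_M | now apply generic_Fn].
Qed.

Lemma truth_eq a b : M a -> M b ->
  (val G a = val G b <-> exists p, G p /\ eqf p a b).
Proof.
  revert b; induction a as [a IH] using (well_founded_ind in_name_wf); intros b Ma Mb; split.
  - intros E.
    (* Densely often, a condition forces equality or it puts into one of the two names a member that
       no extension equates with a member of the other. The last two alternatives contradict the
       equality of the values. *)
    destruct (generic_meets (fun p e => (P p /\ eqf p (e 0) (e 1)) \/
      (exists s, M s /\ exists c, M c /\ (⟨s, c⟩ ∈ e 0 /\ rev_incl p s /\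
        forall r, M r -> forall t, M t -> forall d, M d -> rev_incl r p -> ⟨t, d⟩ ∈ e 1 ->
          rev_incl r t -> ~ (P r /\ eqf r c d))) \/
      (exists t, M t /\ exists d, M d /\ (⟨t, d⟩ ∈ e 1 /\ rev_incl p t /\
        forall r, M r -> forall s, M s -> forall c, M c -> rev_incl r p -> ⟨s, c⟩ ∈ e 0 ->
          rev_incl r s -> ~ (P r /\ eqf r c d)))) (scons a (fun _ => b)) empty)
      as (p & Hp & _ & H).
    + definability.
    + now apply (scons_cl (U := model_family hM) tt).
    + apply generic_empty.
    + simpl; intros p Hp _.
      apply NNPP; intros Hno; apply Hno; exists p; split; auto; split; [apply rev_incl_refl |].
      left; split; auto; constructor.
      * intros q s c Hq Hqp Hsc Hqs; apply NNPP; intros Hn; apply Hno.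
        destruct (opair_mem_cl (U := model_family hM) tt _ _ _ Ma Hsc) as [Ms Mc].
        exists q; split; auto; split; auto; right; left.
        exists s; split; auto; exists c; split_and; auto.
        intros r _ t _ d _ Hrq Htd Hrt [Hr Hcd]; apply Hn; exists r, t, d; auto.
      * intros q t d Hq Hqp Htd Hqt; apply NNPP; intros Hn; apply Hno.
        destruct (opair_mem_cl (U := model_family hM) tt _ _ _ Mb Htd) as [Mt Md].
        exists q; split; auto; split; auto; right; right.
        exists t; split; auto; exists d; split_and; auto.
        intros r _ s _ c _ Hrq Hsc Hrs [Hr Hcd]; apply Hn; exists r, s, c; auto.
    + simpl in H; destruct H as [[_ H] | [(s & Ms & c & Mc & Hsc & Hps & H) | (t & Mt & d & Md & Htd & Hpt & H)]].
      * exists p; auto.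
      * exfalso.
        assert (Hc : val G c ∈ val G b).
        { rewrite <- E; apply mem_val; exists s, c; split_and; auto; now apply (generic_up p). }
        apply mem_val in Hc as (t & d & Htd & Ht & Ecd).
        destruct (opair_mem_cl (U := model_family hM) tt _ _ _ Mb Htd) as [Mt Md].
        apply (IH c (ex_intro _ s Hsc) d Mc Md) in Ecd as (p' & Hp' & Hcd).
        destruct (generic_common p p' Hp Hp') as (q & Hq & Hqp & Hqp').
        destruct (generic_common q t Hq Ht) as (r & Hr & Hrq & Hrt).
        apply (H r (generic_M r Hr) t Mt d Md); auto; [exact (rev_incl_trans _ _ _ Hrq Hqp) |].
        split; [now apply generic_Fn |].
        eapply forces_eq_mono; [apply rev_incl_trans | | exact Hcd];
          exact (rev_incl_trans _ _ _ Hrq Hqp').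
      * exfalso.
        assert (Hd : val G d ∈ val G a).
        { rewrite E; apply mem_val; exists t, d; split_and; auto; now apply (generic_up p). }
        apply mem_val in Hd as (s & c & Hsc & Hs & Ecd).
        destruct (opair_mem_cl (U := model_family hM) tt _ _ _ Ma Hsc) as [Ms Mc].
        symmetry in Ecd; apply (IH c (ex_intro _ s Hsc) d Mc Md) in Ecd as (p' & Hp' & Hcd).
        destruct (generic_common p p' Hp Hp') as (q & Hq & Hqp & Hqp').
        destruct (generic_common q s Hq Hs) as (r & Hr & Hrq & Hrt).
        apply (H r (generic_M r Hr) s Ms c Mc); auto; [exact (rev_incl_trans _ _ _ Hrq Hqp) |].
        split; [now apply generic_Fn |].
        eapply forces_eq_mono; [apply rev_incl_trans | | exact Hcd];
          exact (rev_incl_trans _ _ _ Hrq Hqp').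
  - intros (p & Hp & H); apply forces_eq_inv in H as [H1 H2]; apply V_ext; intros y.
    rewrite !mem_val; split.
    + intros (s & c & Hsc & Hs & ->).
      destruct (opair_mem_cl (U := model_family hM) tt _ _ _ Ma Hsc) as [Ms Mc].
      destruct (generic_common p s Hp Hs) as (q & Hq & Hqp & Hqs).
      destruct (generic_meets (fun r e => exists t, M t /\ exists d, M d /\
        (⟨t, d⟩ ∈ e 1 /\ rev_incl r t /\ (P r /\ eqf r (e 0) d))) (scons c (fun _ => b)) q)
        as (r & Hr & _ & t & Mt & d & Md & Htd & Hrt & _ & Hcd); auto.
      * definability.
      * now apply (scons_cl (U := model_family hM) tt).
      * intros x Hx Hxq; destruct (H1 x s c) as (r & t & d & Hr & Hrx & Htd & Hrt & Hcd); auto;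
          try exact (rev_incl_trans _ _ _ Hxq Hqp); try exact (rev_incl_trans _ _ _ Hxq Hqs).
        destruct (opair_mem_cl (U := model_family hM) tt _ _ _ Mb Htd) as [Mt Md].
        exists r; split_and; auto; exists t; split; auto; exists d; simpl; auto.
      * exists t, d; split_and; auto; [now apply (generic_up r) |].
        apply IH; eauto; now exists s.
    + intros (t & d & Htd & Ht & ->).
      destruct (opair_mem_cl (U := model_family hM) tt _ _ _ Mb Htd) as [Mt Md].
      destruct (generic_common p t Hp Ht) as (q & Hq & Hqp & Hqt).
      destruct (generic_meets (fun r e => exists s, M s /\ exists c, M c /\
        (⟨s, c⟩ ∈ e 1 /\ rev_incl r s /\ (P r /\ eqf r c (e 0)))) (scons d (fun _ => a)) q)
        as (r & Hr & _ & s & Ms & c & Mc & Hsc & Hrs & _ & Hcd); auto.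
      * definability.
      * now apply (scons_cl (U := model_family hM) tt).
      * intros x Hx Hxq; destruct (H2 x t d) as (r & s & c & Hr & Hrx & Hsc & Hrs & Hcd); auto;
          try exact (rev_incl_trans _ _ _ Hxq Hqp); try exact (rev_incl_trans _ _ _ Hxq Hqt).
        destruct (opair_mem_cl (U := model_family hM) tt _ _ _ Ma Hsc) as [Ms Mc].
        exists r; split_and; auto; exists s; split; auto; exists c; simpl; auto.
      * exists s, c; split_and; auto; [now apply (generic_up r) |].
        symmetry; apply IH; eauto; now exists s.
Qed.

Definition extension (x : V) : Prop := exists t, M t /\ x = val G t.

(** [frc] resembles strong forcing: its clauses for membership and existence ask for a witness at
    the condition itself, not merely densely below it. This is harmless, since a true statement only
    has to be forced by some condition of the filter. *)
Lemma truth phi : forall e, (forall n, M (e n)) ->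
  (sat extension (fun n => val G (e n)) phi <-> exists p, G p /\ frc p e phi).
Proof.
  induction phi as [i j | i j | phi IH | phi IH1 psi IH2 | phi IH]; simpl; intros e He.
  - rewrite mem_val; split.
    + intros (t & d & Htd & Ht & E).
      destruct (opair_mem_cl (U := model_family hM) tt _ _ _ (He j) Htd) as [Mt Md].
      apply truth_eq in E as (p & Hp & H); auto.
      destruct (generic_common p t Hp Ht) as (r & Hr & Hrp & Hrt).
      exists r; split; auto; exists t; split; auto; exists d; split_and; auto.
      * now apply generic_Fn.
      * apply (forces_eq_mono P rev_incl rev_incl_trans p); auto.
    + intros (p & Hp & t & Mt & d & Md & Htd & Hpt & _ & H).
      exists t, d; split_and; auto; [now apply (generic_up p) | apply truth_eq; eauto].
  - apply truth_eq; auto.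
  - rewrite IH by auto; split.
    + intros Hno.
      (* The conditions that decide [phi] are dense. *)
      destruct (generic_meets (fun p e => (P p /\ frc p e phi) \/
         (forall q, M q -> P q -> rev_incl q p -> ~ (P q /\ frc q e phi))) e empty)
        as (p & Hp & _ & H); auto.
      * definability.
      * apply generic_empty.
      * intros p Hp _; destruct (classic (exists q, P q /\ rev_incl q p /\ frc q e phi))
          as [(q & Hq & Hqp & H) | H].
        -- exists q; auto.
        -- exists p; split_and; auto; [apply rev_incl_refl |].
           right; intros q _ Hq Hqp [_ H']; apply H; eauto.
      * exists p; split; auto; destruct H as [[_ H] | H]; auto.
        exfalso; apply Hno; eauto.
    + intros (p & Hp & H) (q & Hq & H').
      destruct (generic_common p q Hp Hq) as (r & Hr & Hrp & Hrq).
      assert (P r) by now apply generic_Fn.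
      apply (H r); auto; [now apply generic_M |]; split; auto; apply (frc_mono phi q); auto.
  - rewrite IH1, IH2 by auto; split.
    + intros [(p & Hp & H) (q & Hq & H')].
      destruct (generic_common p q Hp Hq) as (r & Hr & Hrp & Hrq).
      assert (P r) by now apply generic_Fn.
      exists r; split_and; auto; [apply (frc_mono phi p) | apply (frc_mono psi q)]; auto.
    + intros (p & Hp & H & H'); split; exists p; auto.
  - assert (E : forall t, scons (val G t) (fun n => val G (e n)) = (fun n => val G (scons t e n))).
    { intros t; extensionality n; now destruct n. }
    split.
    + intros (x & (t & Mt & ->) & H); rewrite E in H; apply IH in H as (p & Hp & H).
      * exists p; split; auto; exists t; split_and; auto; now apply generic_Fn.
      * now apply (scons_cl (U := model_family hM) tt).
    + intros (p & Hp & t & Mt & _ & H); exists (val G t); split; [exists t; auto |].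
      rewrite E; apply IH; eauto; now apply (scons_cl (U := model_family hM) tt).
Qed.

End Generic.
End Forcing.

(** * Generic extensions *)

Definition upair_name (s t : V) : V := upair ⟨empty, s⟩ ⟨empty, t⟩.
Definition opair_name (s t : V) : V := upair_name (upair_name s s) (upair_name s t).
Definition set_name (x : V) : V := image (fun s => ⟨empty, s⟩) x.

Lemma val_empty G : val G empty = empty.
Proof.
  apply V_ext; intros z; rewrite mem_val; split.
  - intros (p & s & H & _); now apply mem_empty in H.
  - intros H; now apply mem_empty in H.
Qed.

Lemma val_upair_name (G : V -> Prop) s t : G empty ->
  val G (upair_name s t) = upair (val G s) (val G t).
Proof.
  intros H0; apply V_ext; intros z; rewrite mem_val, mem_upair; split.
  - intros (p & u & Hu & _ & ->); apply mem_upair in Hu as [E | E];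
      apply opair_inj in E as [_ ->]; auto.
  - intros [-> | ->]; exists empty; [exists s | exists t]; split_and; auto; apply mem_upair; auto.
Qed.

Lemma val_opair_name (G : V -> Prop) s t : G empty ->
  val G (opair_name s t) = ⟨val G s, val G t⟩.
Proof. intros H0; unfold opair_name; now rewrite !val_upair_name. Qed.

Lemma mem_val_set_name (G : V -> Prop) x z : G empty ->
  z ∈ val G (set_name x) <-> exists s, s ∈ x /\ z = val G s.
Proof.
  intros H0; rewrite mem_val; split.
  - intros (p & s & H & _ & ->); apply mem_image in H as (u & Hu & E).
    apply opair_inj in E as [_ ->]; eauto.
  - intros (s & Hs & ->); exists empty, s; split_and; auto; apply mem_image; eauto.
Qed.

Section Extension.
Variable M : V -> Prop.
Hypothesis hM : ctm M.
Notation P := (Fn M).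

Lemma M_upair_name s t : M s -> M t -> M (upair_name s t).
Proof.
  intros; pose proof (M_empty hM); apply (M_upair hM);
    now apply (opair_cl (U := model_family hM) tt).
Qed.

Lemma M_opair_name s t : M s -> M t -> M (opair_name s t).
Proof. intros; now repeat apply M_upair_name. Qed.

Lemma definable_upair_name s t : mterm hM s -> mterm hM t ->
  mterm hM (fun i e => upair_name (s i e) (t i e)).
Proof.
  intros; pose proof (M_const hM _ (M_empty hM)); unfold upair_name; definability.
Qed.

Lemma definable_opair_name s t : mterm hM s -> mterm hM t ->
  mterm hM (fun i e => opair_name (s i e) (t i e)).
Proof. intros; unfold opair_name; now repeat apply definable_upair_name. Qed.

Lemma definable_set_name s : mterm hM s -> mterm hM (fun i e => set_name (s i e)).
Proof.
  intros; pose proof (M_const hM _ (M_empty hM)); unfold set_name; model_definability.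
Qed.

Lemma M_set_name x : M x -> M (set_name x).
Proof.
  intros Hx; apply (proj1 (definable_set_name _ (M_const hM x Hx)) tt (fun _ => empty)).
  intros _; apply (M_empty hM).
Qed.

Notation filter := {G : V -> Prop | generic M P rev_incl G}.

Lemma extension_trans G x y : extension M G x -> y ∈ x -> extension M G y.
Proof.
  intros (t & Mt & ->) Hy; apply mem_val in Hy as (p & s & Hs & _ & ->).
  destruct (opair_mem_cl (U := model_family hM) tt _ _ _ Mt Hs); exists s; auto.
Qed.

Lemma extension_separation G phi e a : generic M P rev_incl G ->
  (forall n, extension M G (e n)) -> extension M G a ->
  exists b, extension M G b /\
    forall x, x ∈ b <-> x ∈ a /\ sat (extension M G) (scons x e) phi.
Proof.
  intros hG He (ta & Ma & ->).
  (* The sequence of names is chosen outside [M]; only its entries have to belong to [M]. *)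
  assert (Hn : exists n : nat -> V, forall k, M (n k) /\ e k = val G (n k)).
  { exists (fun k => epsilon (inhabits empty) (fun t => M t /\ e k = val G t)).
    intros k; apply epsilon_spec, He. }
  destruct Hn as [n Hn].
  set (psi := fAnd (fMem 0 1) (ren (fun k => match k with 0 => 0 | S k => S (S k) end) phi)).
  destruct (Fn_is_set M hM) as (P0 & H0 & HP0).
  destruct (M_transitive_superset M hM ta Ma) as (T & MT & HaT & Ttr).
  (* Each member of [val G ta] is the value of an element of the transitive set [T], so
     [product P0 T] bounds the entries of the name. Membership in [ta] is part of [psi] and thus
     forced along with [phi]. *)
  destruct (definable_sep (U := model_family hM) (fun _ z e => exists p, M p /\ exists s, M s /\
     (z = ⟨p, s⟩ /\ (P p /\ frc M p (scons s e) psi))) tt (scons ta n) (product P0 T))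
    as (b & Hb & H).
  { apply (definable_ex (U := model_family hM)), (definable_ex (U := model_family hM)),
      definable_and; [definability |].
    eapply definable_iff; [| apply (frc_definable_at M hM psi 1
      (fun k => match k with 0 => 0 | S k => S (S (S k)) end))].
    intros i v _; cbn beta.
    match goal with |- _ /\ frc _ _ ?f _ <-> _ /\ frc _ _ ?g _ => replace f with g; [reflexivity |] end.
    extensionality k; now destruct k. }
  { apply (scons_cl (U := model_family hM) tt); auto; apply Hn. }
  { now apply (M_product M hM). }
  assert (Hsat : forall s, M s -> (sat (extension M G)
    (fun k => val G (scons s (scons ta n) k)) psi <->
    val G s ∈ val G ta /\ sat (extension M G) (scons (val G s) e) phi)).
  { intros s Ms; unfold psi; cbn [sat]; rewrite sat_ren.
    match goal with |- _ /\ sat _ ?f _ <-> _ /\ sat _ ?g _ => replace f with g; [reflexivity |] end.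
    extensionality k; destruct k; simpl; auto; apply Hn. }
  assert (Henv : forall s, M s -> forall k, M (scons s (scons ta n) k)).
  { intros s Ms; apply (scons_cl (U := model_family hM) tt); auto.
    apply (scons_cl (U := model_family hM) tt); auto; apply Hn. }
  exists (val G b); split; [exists b; auto |].
  intros x; rewrite mem_val; split.
  - intros (p & s & Hps & Hp & ->); apply H in Hps as (_ & p' & _ & s' & Ms & E & _ & Hf).
    apply opair_inj in E as [<- <-].
    apply Hsat; auto; apply (truth M hM G hG); eauto.
  - intros [Hx Hphi]; pose proof Hx as Hx'; apply mem_val in Hx' as (t & s & Hts & _ & ->).
    destruct (opair_mem_cl (U := model_family hM) tt _ _ _ Ma Hts) as [_ Ms].
    destruct (proj1 (truth M hM G hG psi _ (Henv s Ms))) as (p & Hp & Hf);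
      [apply Hsat; auto |].
    exists p, s; split_and; auto; apply H; split.
    + apply mem_product; exists p, s; split_and; auto.
      * now apply HP0, (generic_Fn M G hG).
      * apply (Ttr (upair t s)); [|apply mem_upair; auto].
        apply (Ttr ⟨t, s⟩); [|apply mem_upair; auto]; now apply (Ttr ta).
    + exists p; split; [now apply (generic_M M G hG) |]; exists s; split_and; auto.
      now apply (generic_Fn M G hG).
Qed.

(** A parameter is given by one name evaluated at every generic filter. A formula together with its
    parameters is thus the same data for all filters, as [extension_decided] requires. *)
Definition extension_family : family.
Proof.
  refine {| fam_ix := filter;
            fam_cl := fun G => extension M (proj1_sig G);
            fam_const := fun c => exists t, M t /\ forall G, c G = val (proj1_sig G) t |}.
  - intros c (t & Mt & H) G; exists t; auto.
  - exists empty; split; [apply (M_empty hM) | intros; now rewrite val_empty].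
  - intros G; apply extension_trans.
  - intros [G hG] x y (s & Ms & ->) (t & Mt & ->); simpl; exists (upair_name s t); split.
    + now apply M_upair_name.
    + now rewrite val_upair_name by (now apply (generic_empty M hM)).
  - intros [G hG] phi e a He Ha; now apply extension_separation.
Defined.

Lemma extension_const t : M t ->
  @definable_term extension_family (fun G _ => val (proj1_sig G) t).
Proof. intros Mt; apply (definable_const (U := extension_family)); exists t; auto. Qed.

Lemma extension_product G a b : generic M P rev_incl G -> extension M G a -> extension M G b ->
  exists c, extension M G c /\ forall x y, x ∈ a -> y ∈ b -> ⟨x, y⟩ ∈ c.
Proof.
  intros hG (s & Ms & ->) (t & Mt & ->).
  assert (H0 : G empty) by now apply (generic_empty M hM).
  destruct (M_transitive_superset M hM s Ms) as (S & MS & HsS & Str).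
  destruct (M_transitive_superset M hM t Mt) as (T & MT & HtT & Ttr).
  set (c := union (image (fun x => image (fun y => opair_name x y) T) S)).
  assert (Mc : M c).
  { pose proof (M_const hM _ MT) as DT; pose proof (M_const hM _ MS) as DS.
    apply (M_union hM).
    apply (M_image hM (fun x _ => image (fun y => opair_name x y) T) (fun _ => S)); auto.
    model_definability; apply definable_opair_name; definability. }
  assert (comp : forall u v w, (forall x y, x ∈ u -> y ∈ x -> y ∈ u) -> w ∈ u -> v ∈ val G w ->
    exists r, r ∈ u /\ v = val G r).
  { intros u v w Hu Hw Hv; apply mem_val in Hv as (p & r & Hr & _ & ->); exists r; split; auto.
    apply (Hu (upair p r)); [|apply mem_upair; auto].
    apply (Hu ⟨p, r⟩); [|apply mem_upair; auto]; now apply (Hu w). }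
  exists (val G (set_name c)); split; [exists (set_name c); split; auto; now apply M_set_name |].
  intros x y Hx Hy.
  destruct (comp S x s Str HsS Hx) as (x' & Hx' & ->).
  destruct (comp T y t Ttr HtT Hy) as (y' & Hy' & ->).
  apply mem_val_set_name; auto; exists (opair_name x' y'); split.
  - apply mem_union; exists (image (fun y => opair_name x' y) T); split; apply mem_image; eauto.
  - now rewrite val_opair_name.
Qed.

(** The values of the elements of a transitive set of names form a transitive set. *)
Lemma extension_transitive_superset G a : generic M P rev_incl G -> extension M G a ->
  exists c, extension M G c /\ a ∈ c /\ forall x y, x ∈ c -> y ∈ x -> y ∈ c.
Proof.
  intros hG (t & Mt & ->).
  assert (H0 : G empty) by now apply (generic_empty M hM).
  destruct (M_transitive_superset M hM t Mt) as (T & MT & HtT & Ttr).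
  exists (val G (set_name T)); split_and.
  - exists (set_name T); split; auto; now apply M_set_name.
  - apply mem_val_set_name; eauto.
  - intros x y Hx Hy; apply mem_val_set_name in Hx as (s & Hs & ->); auto.
    apply mem_val in Hy as (p & r & Hr & _ & ->); apply mem_val_set_name; auto; exists r; split; auto.
    apply (Ttr (upair p r)); [|apply mem_upair; auto].
    apply (Ttr ⟨p, r⟩); [|apply mem_upair; auto]; now apply (Ttr s).
Qed.

(** Replacing parameters by their names turns [S] into a single statement about [frc]. A condition
    that witnesses it for [G] witnesses it for every generic filter to which it belongs. *)
Lemma extension_decided (S : (V -> Prop) -> Prop) G :
  @definable extension_family (fun G _ => S (proj1_sig G)) ->
  generic M P rev_incl G -> S G ->
  exists p, G p /\ forall G', generic M P rev_incl G' -> G' p -> S G'.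
Proof.
  intros (phi & c & Hc & Hphi) hG HS.
  assert (Hn : exists n : nat -> V, forall k, M (n k) /\ forall G, c k G = val (proj1_sig G) (n k)).
  { exists (fun k => epsilon (inhabits empty) (fun t => M t /\ forall G, c k G = val (proj1_sig G) t)).
    intros k; apply epsilon_spec, Hc. }
  destruct Hn as [n Hn].
  assert (E : forall G', generic M P rev_incl G' -> (S G' <-> exists p, G' p /\ frc M p
     (mix (fun _ => empty) n) phi)).
  { intros G' hG'; rewrite <- (truth M hM G' hG').
    - rewrite <- (Hphi (exist _ G' hG') (fun _ => empty)).
      + match goal with |- sat _ ?f _ <-> sat _ ?g _ => replace f with g; [reflexivity |] end.
        extensionality k; unfold mix; destruct (parity k); [now rewrite val_empty |].
        symmetry; apply (proj2 (Hn _)).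
      + intros _; exists empty; split; [apply (M_empty hM) | now rewrite val_empty].
    - intros k; unfold mix; destruct (parity k); [apply (M_empty hM) | apply Hn]. }
  destruct (proj1 (E G hG) HS) as (p & Hp & Hf).
  exists p; split; auto; intros G' hG' Hp'; apply (E G' hG'); eauto.
Qed.

End Extension.

(** * Transpositions of a generic filter *)

Lemma swap_involutive a b n : swap a b (swap a b n) = n.
Proof.
  unfold swap; destruct (Nat.eqb_spec n a) as [-> | Ha];
    [|destruct (Nat.eqb_spec n b) as [-> | Hb]].
  - rewrite Nat.eqb_refl; now destruct (Nat.eqb_spec b a).
  - now rewrite Nat.eqb_refl.
  - apply Nat.eqb_neq in Ha, Hb; now rewrite Ha, Hb.
Qed.

Lemma swap_left a b : swap a b a = b.
Proof. unfold swap; now rewrite Nat.eqb_refl. Qed.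

Lemma swap_other a b n : n <> a -> n <> b -> swap a b n = n.
Proof. intros; unfold swap; destruct (Nat.eqb_spec n a), (Nat.eqb_spec n b); congruence. Qed.

Lemma cond_bound (p : V) : finite p ->
  exists N, forall i j v, ⟨⟨num i, num j⟩, v⟩ ∈ p -> i < N /\ j < N.
Proof.
  intros [l Hl].
  assert (H : exists N, forall i j v, In ⟨⟨num i, num j⟩, v⟩ l -> i < N /\ j < N).
  { clear Hl; induction l as [|z l [N IH]]; [exists 0; intros i j v [] |].
    destruct (classic (exists i j v, z = ⟨⟨num i, num j⟩, v⟩)) as [(i & j & v & ->) | Hz].
    - exists (N + S i + S j); intros i' j' v' [E | H].
      + apply opair_inj in E as [E _]; apply opair_inj in E as [E1 E2].
        apply num_inj in E1, E2; subst; lia.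
      + apply IH in H; lia.
    - exists N; intros i j v [E | H]; eauto; exfalso; eauto 6. }
  destruct H as [N H]; exists N; intros i j v Hv; eauto.
Qed.

Section Transposition.
Variable M : V -> Prop.
Hypothesis hM : ctm M.
Notation P := (Fn M).

Lemma Fn_empty : P empty.
Proof.
  unfold Fn; split_and; [apply (M_empty hM) | exists nil; intros z Hz | intros z Hz | intros u v w Hz];
    now apply mem_empty in Hz.
Qed.

Lemma M_entry i j b : M ⟨⟨num i, num j⟩, num b⟩.
Proof.
  repeat apply (opair_cl (U := model_family hM) tt); apply (M_num M hM).
Qed.

Lemma Fn_extend p i j b : P p -> b < 2 -> (forall v, ~ ⟨⟨num i, num j⟩, v⟩ ∈ p) ->
  P (cup p (upair ⟨⟨num i, num j⟩, num b⟩ ⟨⟨num i, num j⟩, num b⟩)).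
Proof.
  intros (Mp & Hf & Hs & Hfun) Hb Hfresh; unfold Fn; split_and.
  - pose proof (M_entry i j b); apply (M_cup hM); auto; now apply (M_upair hM).
  - now apply finite_add.
  - intros z Hz; apply mem_cup in Hz as [Hz | Hz]; auto.
    apply mem_upair in Hz; exists i, j, b; tauto.
  - assert (new : forall u v, ⟨u, v⟩ ∈ upair ⟨⟨num i, num j⟩, num b⟩ ⟨⟨num i, num j⟩, num b⟩ ->
      u = ⟨num i, num j⟩ /\ v = num b).
    { intros u v H; apply mem_upair in H as [H | H]; now apply opair_inj in H. }
    intros u v w Hv Hw; apply mem_cup in Hv as [Hv | Hv]; apply mem_cup in Hw as [Hw | Hw].
    + now apply (Hfun u).
    + apply new in Hw as [-> _]; now apply Hfresh in Hv.
    + apply new in Hv as [-> _]; now apply Hfresh in Hw.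
    + apply new in Hv as [_ ->]; now apply new in Hw as [_ ->].
Qed.

Lemma act_cond_incl f p q : rev_incl p q -> rev_incl (act_cond f p) (act_cond f q).
Proof.
  intros H z Hz; apply mem_act_cond in Hz as (i & j & b & Hb & ->).
  apply mem_act_cond; exists i, j, b; auto.
Qed.

Lemma act_cond_empty f : act_cond f empty = empty.
Proof.
  apply V_ext; intros z; rewrite mem_act_cond; split.
  - intros (i & j & b & H & _); now apply mem_empty in H.
  - intros H; now apply mem_empty in H.
Qed.

Lemma act_cond_comp f g p : P p -> (forall n, g (f n) = n) -> act_cond g (act_cond f p) = p.
Proof.
  intros (_ & _ & Hs & _) Hgf; apply V_ext; intros z; rewrite mem_act_cond; split.
  - intros (i & j & b & H & ->); apply mem_act_cond in H as (i' & j' & b' & H & E).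
    apply opair_inj in E as [E ->]; apply opair_inj in E as [E1 E2].
    apply num_inj in E1 as ->; now rewrite Hgf, E2.
  - intros Hz; destruct (Hs z Hz) as (i & j & b & _ & ->).
    exists (f i), j, (num b); rewrite Hgf; split; auto; apply mem_act_cond; eauto.
Qed.

Lemma act_cond_Fn f g p : (forall n, g (f n) = n) -> P p -> P (act_cond f p).
Proof.
  intros Hgf (Mp & Hf & Hs & Hfun).
  assert (Hs' : forall z, z ∈ act_cond f p ->
    exists i j b, b < 2 /\ z = ⟨⟨num i, num j⟩, num b⟩).
  { intros z Hz; apply mem_act_cond in Hz as (i & j & b & H & ->).
    destruct (Hs _ H) as (i' & j' & b' & Hb & E); apply opair_inj in E as [_ ->]; eauto 6. }
  assert (Hf' : finite (act_cond f p)).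
  { destruct Hf as [l Hl].
    exists (map (fun z => epsilon (inhabits empty) (fun w => exists i j b,
      z = ⟨⟨num i, num j⟩, b⟩ /\ w = ⟨⟨num (f i), num j⟩, b⟩)) l).
    intros z Hz; apply mem_act_cond in Hz as (i & j & b & H & ->).
    apply in_map_iff; exists ⟨⟨num i, num j⟩, b⟩; split; auto.
    match goal with |- epsilon ?i ?Q = _ => assert (HQ : Q (epsilon i Q)) end.
    { apply epsilon_spec; exists ⟨⟨num (f i), num j⟩, b⟩; eauto. }
    destruct HQ as (i' & j' & b' & E & ->).
    apply opair_inj in E as [E ->]; apply opair_inj in E as [E1 E2].
    apply num_inj in E1, E2; now subst. }
  unfold Fn; split_and; auto.
  - apply (M_finite M hM); auto; intros z Hz.
    destruct (Hs' z Hz) as (i & j & b & _ & ->); apply M_entry.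
  - intros u v w Hv Hw; apply mem_act_cond in Hv as (i & j & b & Hv & E).
    apply mem_act_cond in Hw as (i' & j' & b' & Hw & E').
    apply opair_inj in E as [-> ->]; apply opair_inj in E' as [E ->].
    apply opair_inj in E as [E1 E2]; apply num_inj in E1, E2; subst.
    rewrite <- (Hgf i), E1, Hgf in Hv; eauto.
Qed.

Section Generic.
Variables (G : V -> Prop) (a b : nat).
Hypothesis hG : generic M P rev_incl G.

(** The image of [G] under the transposition, written as a preimage; the two agree because a
    transposition is its own inverse. *)
Definition swapped_filter (q : V) : Prop := P q /\ G (act_cond (swap a b) q).

Lemma act_swap_Fn p : P p -> P (act_cond (swap a b) p).
Proof. apply (act_cond_Fn _ (swap a b)), swap_involutive. Qed.

Lemma act_swap_twice p : P p -> act_cond (swap a b) (act_cond (swap a b) p) = p.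
Proof. intros Hp; apply act_cond_comp; auto; apply swap_involutive. Qed.

(** The transposition as a relation between numerals of the universe, so that a formula can express
    it. *)
Definition is_swap (x y : V) : Prop :=
  (x = num a /\ y = num b) \/ (x = num b /\ y = num a) \/
  ((x <> num a /\ x <> num b) /\ y = x).

Lemma is_swap_num n y : is_swap (num n) y <-> y = num (swap a b n).
Proof.
  unfold is_swap, swap; destruct (Nat.eqb_spec n a) as [-> | Ha];
    [|destruct (Nat.eqb_spec n b) as [-> | Hb]]; split.
  - intros [[_ ->] | [[E ->] | [[H _] _]]]; congruence.
  - auto.
  - intros [[E ->] | [[_ ->] | [[_ H] _]]]; congruence.
  - auto.
  - intros [[E ->] | [[E ->] | [_ ->]]]; auto; now apply num_inj in E.
  - intros ->; right; right; split; auto; split; intros E; now apply num_inj in E.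
Qed.

(** A relation is all that is needed to transport a dense set. A definable term would in addition
    have to map every set of [M] into [M]. *)
Lemma act_swap_definable : exists R : V -> V -> Prop,
  mdefinable hM (fun _ e => R (e 0) (e 1)) /\
  forall q d, M q -> M d -> (R q d <-> d = act_cond (swap a b) q).
Proof.
  exists (fun q d => forall z, M z -> (z ∈ d <-> exists i, M i /\ exists j, M j /\
    exists v, M v /\ exists i', M i' /\ (i ∈ omega /\ j ∈ omega /\ is_swap i i' /\
      ⟨⟨i, j⟩, v⟩ ∈ q /\ z = ⟨⟨i', j⟩, v⟩))); split.
  - pose proof (M_const hM _ (M_omega M hM)) as Hom.
    pose proof (M_const hM _ (M_num M hM a)); pose proof (M_const hM _ (M_num M hM b)).
    unfold is_swap; definability.
  - intros q d Mq Md.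
    assert (H : forall z, M z -> ((exists i, M i /\ exists j, M j /\
      exists v, M v /\ exists i', M i' /\ (i ∈ omega /\ j ∈ omega /\ is_swap i i' /\
      ⟨⟨i, j⟩, v⟩ ∈ q /\ z = ⟨⟨i', j⟩, v⟩)) <-> z ∈ act_cond (swap a b) q)).
    { intros z Mz; rewrite mem_act_cond; split.
      - intros (i & _ & j & _ & v & _ & i' & _ & Hi & Hj & Hii & Hq & ->).
        apply mem_omega in Hi as [i0 ->]; apply mem_omega in Hj as [j0 ->].
        apply is_swap_num in Hii as ->; eauto.
      - intros (i & j & v & Hq & ->).
        destruct (opair_mem_cl (U := model_family hM) tt _ _ _ Mq Hq) as [_ Mv].
        exists (num i); split; [apply (M_num M hM) |].
        exists (num j); split; [apply (M_num M hM) |].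
        exists v; split; auto; exists (num (swap a b i)); split; [apply (M_num M hM) |].
        split_and; auto; try (apply mem_omega; eauto); now apply is_swap_num. }
    split.
    + intros HR; apply V_ext; intros z; split; intros Hz.
      * assert (Mz : M z) by now apply (M_trans hM d).
        apply H; auto; now apply HR.
      * assert (Mz : M z).
        { apply mem_act_cond in Hz as (i & j & v & Hq & ->).
          destruct (opair_mem_cl (U := model_family hM) tt _ _ _ Mq Hq) as [_ Mv].
          repeat apply (opair_cl (U := model_family hM) tt); auto; apply (M_num M hM). }
        apply HR; auto; now apply H.
    + intros -> z Mz; symmetry; auto.
Qed.

Lemma swapped_generic : generic M P rev_incl swapped_filter.
Proof.
  assert (act_in : forall p, G p -> swapped_filter (act_cond (swap a b) p)).
  { intros p Hp; pose proof (generic_Fn M G hG p Hp); split; [now apply act_swap_Fn |].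
    now rewrite act_swap_twice. }
  unfold generic; split_and.
  - now intros p [Hp _].
  - exists empty; split; [apply Fn_empty |]; rewrite act_cond_empty.
    now apply (generic_empty M hM).
  - intros p q [Hp HGp] Hq Hpq; split; auto.
    apply (generic_up M G hG (act_cond (swap a b) p)); auto.
    + now apply act_swap_Fn in Hq as [? _].
    + now apply act_cond_incl.
  - intros p q [Hp HGp] [Hq HGq].
    destruct (generic_common M G hG _ _ HGp HGq) as (r & Hr & Hrp & Hrq).
    exists (act_cond (swap a b) r); split; auto; split.
    + rewrite <- (act_swap_twice p Hp); now apply act_cond_incl.
    + rewrite <- (act_swap_twice q Hq); now apply act_cond_incl.
  - intros D MD HDP Hdense.
    destruct act_swap_definable as (R & HR & HRact).
    destruct (Fn_is_set M hM) as (P0 & H0 & HP0).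
    (* [D'] is the preimage of [D] under the transposition; it lies in [M] by the definability of
       the action on conditions. *)
    destruct (definable_sep (U := model_family hM) (fun _ q e => exists d, M d /\
      (d ∈ e 0 /\ R q d)) tt (fun _ => D) P0) as (D' & MD' & HD'); auto.
    { definability.
      apply (definable_ren _ (fun n => match n with 0 => 1 | _ => 0 end)) in HR; exact HR. }
    assert (HD : forall q, q ∈ D' <-> P q /\ act_cond (swap a b) q ∈ D).
    { intros q; rewrite HD', HP0; split.
      - intros [Hq (d & Md & Hd & Hqd)]; split; auto.
        apply HRact in Hqd as <-; auto; apply Hq.
      - intros [Hq Hd]; split; auto.
        assert (M (act_cond (swap a b) q)) by now apply (M_trans hM D).
        exists (act_cond (swap a b) q); split_and; auto; apply HRact; auto; apply Hq. }
    destruct hG as (_ & _ & _ & _ & Hmeet); destruct (Hmeet D') as (q & Hq & HGq); auto.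
    + intros d Hd; now apply HD in Hd.
    + intros p Hp; destruct (Hdense _ (act_swap_Fn p Hp)) as (d & Hd & Hdp).
      exists (act_cond (swap a b) d); split.
      * apply HD; split; [now apply act_swap_Fn, HDP | now rewrite act_swap_twice; auto].
      * rewrite <- (act_swap_twice p Hp); now apply act_cond_incl.
    + apply HD in Hq as [Hq Hd]; exists (act_cond (swap a b) q); auto.
Qed.

(** That [t] is a name ensures that the first components of its entries are conditions, as
    membership in [swapped_filter] demands. *)
Lemma val_swapped t : is_name P t -> val swapped_filter t = val G (act (swap a b) t).
Proof.
  induction t as [t IH] using (well_founded_ind in_name_wf); intros [Ht].
  apply V_ext; intros z; rewrite !mem_val; split.
  - intros (p & s & Hps & [Hp HGp] & ->).
    exists (act_cond (swap a b) p), (act (swap a b) s); split_and; auto.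
    + apply mem_act; eauto.
    + apply IH; [now exists p |]; destruct (Ht _ Hps) as (p' & s' & E & _ & Hs).
      now apply opair_inj in E as [_ ->].
  - intros (p & s & Hps & HGp & ->); apply mem_act in Hps as (p' & s' & Hps & E).
    apply opair_inj in E as [-> ->]; destruct (Ht _ Hps) as (p0 & s0 & E & Hp & Hs).
    apply opair_inj in E as [<- <-]; exists p', s'; split_and; auto; [now split |].
    symmetry; apply IH; auto; now exists p'.
Qed.

Lemma cohen_real_swapped n : cohen_real swapped_filter n = cohen_real G (swap a b n).
Proof.
  apply V_ext; intros z; rewrite !mem_cohen_real; split.
  - intros (k & p & [Hp HGp] & H & ->); exists k, (act_cond (swap a b) p); split_and; auto.
    apply mem_act_cond; eauto.
  - intros (k & p & Hp & H & ->); pose proof (generic_Fn M G hG p Hp) as HP.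
    exists k, (act_cond (swap a b) p); split_and; auto.
    + split; [now apply act_swap_Fn | now rewrite act_swap_twice].
    + apply mem_act_cond; exists (swap a b n), k, (num 1); now rewrite swap_involutive.
Qed.

Lemma cohen_set_swapped : cohen_set swapped_filter = cohen_set G.
Proof.
  apply V_ext; intros z; rewrite !mem_cohen_set; split; intros [n ->].
  - exists (swap a b n); apply cohen_real_swapped.
  - exists (swap a b n); now rewrite cohen_real_swapped, swap_involutive.
Qed.

End Generic.

(** * Genericity of the Cohen reals *)

Section CohenReals.
Variable G : V -> Prop.
Hypothesis hG : generic M P rev_incl G.

(** At a column beyond the domain of a condition, the rows [i] and [j] can still be given the values
    1 and 0. *)
Lemma cohen_real_separated i j : i <> j ->
  exists k, num k ∈ cohen_real G i /\ ~ num k ∈ cohen_real G j.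
Proof.
  intros Hij.
  destruct (generic_meets M hM G hG (fun p _ => exists k, M k /\ (k ∈ omega /\
    ⟨⟨num i, k⟩, num 1⟩ ∈ p /\ ⟨⟨num j, k⟩, num 0⟩ ∈ p)) (fun _ => empty) empty)
    as (p & Hp & _ & x & _ & Hx & H1 & H0).
  - pose proof (M_const hM _ (M_omega M hM)) as Hom.
    pose proof (M_const hM _ (M_num M hM i)); pose proof (M_const hM _ (M_num M hM j)).
    pose proof (M_const hM _ (M_num M hM 0)); pose proof (M_const hM _ (M_num M hM 1)).
    definability.
  - intros _; apply (M_empty hM).
  - now apply (generic_empty M hM).
  - intros p Hp _; destruct (cond_bound p) as [N HN]; [apply Hp |].
    pose proof (Fn_extend p i N 1 Hp) as H1.
    set (p1 := cup p _) in H1.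
    pose proof (Fn_extend p1 j N 0) as H2; set (p2 := cup p1 _) in H2.
    assert (P1 : P p1).
    { apply H1; auto; intros v Hv; apply HN in Hv; lia. }
    assert (P2 : P p2).
    { apply H2; auto; intros v Hv; apply mem_cup in Hv as [Hv | Hv].
      - apply HN in Hv; lia.
      - apply mem_upair in Hv as [E | E]; apply opair_inj in E as [E _];
          apply opair_inj in E as [E _]; apply num_inj in E; congruence. }
    exists p2; split_and; auto.
    + intros z Hz; apply mem_cup; left; apply mem_cup; auto.
    + exists (num N); split_and; [apply (M_num M hM) | apply mem_omega; eauto | |].
      * apply mem_cup; left; apply mem_cup; right; apply mem_upair; auto.
      * apply mem_cup; right; apply mem_upair; auto.
  - apply mem_omega in Hx as [k ->]; exists k; split.
    + apply mem_cohen_real; eauto.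
    + intros H; apply mem_cohen_real in H as (k' & q & Hq & H & E).
      apply num_inj in E as <-.
      destruct (generic_common M G hG p q Hp Hq) as (r & Hr & Hrp & Hrq).
      apply (generic_Fn M G hG) in Hr as (_ & _ & _ & Hfun).
      assert (E : num 0 = num 1) by (apply (Hfun ⟨num j, num k⟩); auto).
      now apply num_inj in E.
Qed.

Lemma cohen_real_inj i j : cohen_real G i = cohen_real G j -> i = j.
Proof.
  intros E; destruct (Nat.eq_dec i j) as [|H]; auto.
  destruct (cohen_real_separated i j H) as (k & H1 & H2); rewrite E in H1; contradiction.
Qed.

(** By genericity some late row [b], not mentioned by [p], repeats everything that [p] says about
    row [a]. The transposed condition is then contained in a common extension of [p] and the
    condition that made this copy. *)
Lemma fresh_swap a N p : G p -> exists b, N <= b /\ G (act_cond (swap a b) p).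
Proof.
  intros Hp; pose proof (generic_Fn M G hG p Hp) as PP.
  pose proof (generic_M M G hG p Hp) as Mp.
  destruct (cond_bound p) as [K HK]; [apply PP |].
  (* The three summands place the new row beyond [N], outside the domain of [p], and beyond [a]. *)
  destruct (generic_meets M hM G hG (fun q _ => exists y, M y /\ (y ∈ omega /\
    ~ y ∈ num (N + K + S a) /\ forall x, M x -> forall v, M v ->
      ⟨⟨num a, x⟩, v⟩ ∈ p -> ⟨⟨y, x⟩, v⟩ ∈ q)) (fun _ => empty) empty)
    as (q & Hq & _ & y & _ & Hy & Hyb & Hyq).
  - pose proof (M_const hM _ (M_omega M hM)) as Hom; pose proof (M_const hM p Mp).
    pose proof (M_const hM _ (M_num M hM (N + K + S a))).
    pose proof (M_const hM _ (M_num M hM a)); definability.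
  - intros _; apply (M_empty hM).
  - now apply (generic_empty M hM).
  - intros p' Hp' _; destruct (cond_bound p') as [L HL]; [apply Hp' |].
    (* Being at least [L], this row is empty in [p'], so the copied row cannot clash with it. *)
    set (b := N + K + S a + L).
    assert (Hact : P (act_cond (swap a b) p)) by now apply act_swap_Fn.
    (* The copy of row [a] is cut out of the transposed condition, from which it inherits finiteness
       and single-valuedness. *)
    set (row := setOf (fun z => z ∈ act_cond (swap a b) p /\ exists x v, z = ⟨⟨num b, x⟩, v⟩)).
    assert (Hrow : forall z, z ∈ row <->
      z ∈ act_cond (swap a b) p /\ exists x v, z = ⟨⟨num b, x⟩, v⟩).
    { intros z; apply mem_setOf; destruct (V_sup (act_cond (swap a b) p)) as (A & f & E).
      exists A, f; intros w [Hw _]; rewrite E in Hw; now apply mem_sup in Hw. }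
    assert (Hdisj : forall u v w, ⟨u, v⟩ ∈ p' -> ⟨u, w⟩ ∈ row -> False).
    { intros u v w Hv Hw; apply Hrow in Hw as [Hw (x & v' & E)].
      apply opair_inj in E as [-> ->].
      destruct Hp' as (_ & _ & Hs & _); destruct (Hs _ Hv) as (i & j & c & _ & E).
      apply opair_inj in E as [E ->]; apply opair_inj in E as [E1 E2]; subst x.
      apply HL in Hv; unfold b in Hv; lia. }
    exists (cup p' row); split_and.
    + destruct Hact as (Ma & [la Hla] & Hsa & Hfa); destruct Hp' as (Mp' & [l Hl] & Hs & Hf).
      assert (Hfin : finite (cup p' row)).
      { exists (l ++ la); intros z Hz; apply in_or_app; apply mem_cup in Hz as [Hz | Hz]; auto.
        apply Hrow in Hz as [Hz _]; auto. }
      assert (Hs' : forall z, z ∈ cup p' row ->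
         exists i j b, b < 2 /\ z = ⟨⟨num i, num j⟩, num b⟩).
      { intros z Hz; apply mem_cup in Hz as [Hz | Hz]; auto; apply Hrow in Hz as [Hz _]; auto. }
      unfold Fn; split_and; auto.
      * apply (M_finite M hM); auto; intros z Hz.
        destruct (Hs' z Hz) as (i & j & c & _ & ->); apply M_entry.
      * intros u v w Hv Hw; apply mem_cup in Hv as [Hv | Hv]; apply mem_cup in Hw as [Hw | Hw];
          eauto; try (exfalso; eapply Hdisj; eauto; fail).
        apply Hrow in Hv as [Hv _]; apply Hrow in Hw as [Hw _]; eauto.
    + intros z Hz; apply mem_cup; auto.
    + exists (num b); split_and; [apply (M_num M hM) | apply mem_omega; eauto | |].
      * intros H; apply mem_num in H as (k & Hk & E); apply num_inj in E; unfold b in E; lia.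
      * intros x _ v _ Hxv; apply mem_cup; right; apply Hrow; split; eauto.
        destruct PP as (_ & _ & Hs & _); destruct (Hs _ Hxv) as (i & j & c & _ & E).
        apply opair_inj in E as [E ->]; apply opair_inj in E as [E1 E2]; subst x.
        apply mem_act_cond; exists a, j, (num c); split; auto; now rewrite swap_left.
  - apply mem_omega in Hy as [b ->]; exists b.
    assert (Hb : N + K + S a <= b).
    { destruct (le_lt_dec (N + K + S a) b) as [|Hlt]; auto.
      exfalso; apply Hyb, mem_num; eauto. }
    split; [lia |].
    destruct (generic_common M G hG p q Hp Hq) as (r & Hr & Hrp & Hrq).
    apply (generic_up M G hG r); auto; [exact (proj1 (act_swap_Fn a b p PP)) |].
    (* An entry from row [a] has moved to row [b], where [q] contains it. All other rows of [p] are
       different from [b], since [K <= b], and stay in place. *)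
    intros z Hz; apply mem_act_cond in Hz as (i & j & v & Hv & ->).
    destruct (HK _ _ _ Hv) as [Hi _].
    destruct (Nat.eq_dec i a) as [-> | Hia].
    + rewrite swap_left; apply Hrq.
      destruct (opair_mem_cl (U := model_family hM) tt _ _ _ Mp Hv) as [_ Mv].
      apply Hyq; auto; apply (M_num M hM).
    + rewrite swap_other by lia; auto.
Qed.

End CohenReals.
End Transposition.

(** * Names in the symmetric model *)

Definition singleton (x : V) : V := upair x x.

Lemma mem_singleton x z : z ∈ singleton x <-> z = x.
Proof. unfold singleton; rewrite mem_upair; tauto. Qed.

Definition numeral_name (k : nat) : V :=
  Nat.iter k (fun u => cup u (singleton ⟨empty, u⟩)) empty.

(** In a poset with weakest condition ∅ this is the canonical name of the k-th Zermelo numeral. Each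
    level has a single entry, so forced equalities can be peeled off level by level. *)
Definition chain (k : nat) : V := Nat.iter k (fun u => singleton ⟨empty, u⟩) empty.

(** A Cohen name whose value [chain k] is again a name, now for the poset of injections. *)
Definition chain_name (k : nat) : V :=
  Nat.iter k (fun u => singleton ⟨empty, opair_name empty u⟩) empty.

Definition bit (x y : V) : V := singleton ⟨⟨x, y⟩, num 1⟩.

(** At the index [num n] the value is the set of all values of [s k] with k in the n-th Cohen real.
    The index is a set, not a natural number, so that the name is a definable term in it. *)
Definition indexed_name (s : nat -> V) (x : V) : V := range (fun k => ⟨bit x (num k), s k⟩).

Definition real_name (n : nat) : V := indexed_name numeral_name (num n).

Definition value_name (n : nat) : V :=
  indexed_name (fun k => opair_name empty (chain_name k)) (num n).

(** The name [value x], for a poset with weakest condition [empty], codes the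
    set [x] of natural numbers, the number [k] being represented by [chain k]. *)
Definition value (x : V) : V := setOf (fun z => exists k, num k ∈ x /\ z = ⟨empty, chain k⟩).

Lemma mem_value x z : z ∈ value x <-> exists k, num k ∈ x /\ z = ⟨empty, chain k⟩.
Proof. apply mem_setOf; exists nat, (fun k => ⟨empty, chain k⟩); intros y (k & _ & ->); eauto. Qed.

Definition fixed_point (x : V) : V := singleton ⟨x, x⟩.

Definition fixed_point_name (n : nat) : V :=
  upair_name (opair_name (real_name n) (real_name n)) (opair_name (real_name n) (real_name n)).

(** The Cohen name of σ: its value pairs the condition containing only (x_n, x_n) with the code of
    x_n. Automorphisms merely permute the indices n, so the whole group fixes it. *)
Definition fixed_points_name : V :=
  range (fun n => ⟨empty, opair_name (fixed_point_name n) (value_name n)⟩).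

(** The list of indices does not mention the filter; the same list is read once with the reals of
    [G] and once with those of the transposed filter. *)
Definition relation (x : nat -> V) (g : list (nat * nat)) : V :=
  setOf (fun z => exists i j, In (i, j) g /\ z = ⟨x i, x j⟩).

Lemma mem_relation x g z : z ∈ relation x g <-> exists i j, In (i, j) g /\ z = ⟨x i, x j⟩.
Proof.
  apply mem_setOf; exists (nat * nat)%type, (fun p => ⟨x (fst p), x (snd p)⟩).
  intros y (i & j & _ & ->); now exists (i, j).
Qed.

Definition pair_name (x y : V) : V :=
  ⟨empty, opair_name (indexed_name numeral_name x) (indexed_name numeral_name y)⟩.

Definition relation_name (g : list (nat * nat)) : V :=
  setOf (fun z => exists i j, In (i, j) g /\ z = pair_name (num i) (num j)).

Lemma mem_relation_name g z :
  z ∈ relation_name g <-> exists i j, In (i, j) g /\ z = pair_name (num i) (num j).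
Proof.
  apply mem_setOf; exists (nat * nat)%type, (fun p => pair_name (num (fst p)) (num (snd p))).
  intros y (i & j & _ & ->); now exists (i, j).
Qed.

Lemma finite_list_image (h : nat * nat -> V) g x :
  (forall z, z ∈ x -> exists i j, In (i, j) g /\ z = h (i, j)) -> finite x.
Proof.
  intros H; exists (map h g); intros z Hz; destruct (H z Hz) as (i & j & Hij & ->).
  now apply in_map.
Qed.

Lemma finite_relation x g : finite (relation x g).
Proof.
  apply (finite_list_image (fun p => ⟨x (fst p), x (snd p)⟩) g).
  intros z Hz; now apply mem_relation in Hz.
Qed.

Lemma finite_relation_name g : finite (relation_name g).
Proof.
  apply (finite_list_image (fun p => pair_name (num (fst p)) (num (snd p))) g).
  intros z Hz; now apply mem_relation_name in Hz.
Qed.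

Section Names.
Variable M : V -> Prop.
Hypothesis hM : ctm M.
Notation P := (Fn M).

(** ** Names that belong to the ground model *)

Lemma definable_apply (T : V -> V) t :
  mterm hM (fun _ e => T (e 0)) -> mterm hM t -> mterm hM (fun i e => T (t i e)).
Proof.
  intros [H1 H2] Ht; split.
  - intros i e He; apply (H1 i (fun _ => t i e)); intros _; now apply Ht.
  - apply (definable_subst (fun i x e => e 0 = T x)).
    + apply (definable_ren _ (fun n => match n with 0 => 1 | _ => 0 end)) in H2; exact H2.
    + now apply (definable_term_ren _ S).
Qed.

Lemma definable_bit s t : mterm hM s -> mterm hM t -> mterm hM (fun i e => bit (s i e) (t i e)).
Proof.
  intros; pose proof (M_const hM _ (M_num M hM 1)); unfold bit, singleton; definability.
Qed.

Lemma definable_iterated_name F a (h : V -> V) :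
  mterm hM (fun _ e => F (e 0)) -> M a -> mterm hM (fun _ e => h (e 0)) ->
  mterm hM (fun _ e => indexed_name (fun k => h (Nat.iter k F a)) (e 0)).
Proof.
  intros HF Ha Hh; apply (definable_range M hM F HF a Ha (fun x y e => ⟨bit (e 0) x, h y⟩)).
  definability; [apply definable_bit; definability |].
  apply (definable_apply h); auto; definability.
Qed.

Lemma definable_real_name : mterm hM (fun _ e => indexed_name numeral_name (e 0)).
Proof.
  pose proof (M_const hM _ (M_empty hM)).
  apply (definable_iterated_name _ _ (fun x => x)); [|apply (M_empty hM) | definability].
  unfold singleton; model_definability.
Qed.

Lemma definable_value_name :
  mterm hM (fun _ e => indexed_name (fun k => opair_name empty (chain_name k)) (e 0)).
Proof.
  pose proof (M_const hM _ (M_empty hM)).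
  apply (definable_iterated_name _ _ (opair_name empty)); [|apply (M_empty hM) |].
  - unfold singleton; definability; apply definable_opair_name; definability.
  - apply definable_opair_name; definability.
Qed.

Lemma M_real_name n : M (real_name n).
Proof. apply (proj1 definable_real_name tt (fun _ => num n)); intros _; apply (M_num M hM). Qed.

Lemma M_value_name n : M (value_name n).
Proof. apply (proj1 definable_value_name tt (fun _ => num n)); intros _; apply (M_num M hM). Qed.

Lemma M_fixed_points_name : M fixed_points_name.
Proof.
  pose proof (M_const hM _ (M_empty hM)).
  assert (H' : mterm hM (fun _ e => ⟨empty, opair_name
     (upair_name (opair_name (indexed_name numeral_name (e 0)) (indexed_name numeral_name (e 0)))
        (opair_name (indexed_name numeral_name (e 0)) (indexed_name numeral_name (e 0))))
     (indexed_name (fun k => opair_name empty (chain_name k)) (e 0))⟩)).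
  { apply definable_opair; [assumption |]; apply definable_opair_name.
    - apply definable_upair_name; apply definable_opair_name; apply definable_real_name.
    - apply definable_value_name. }
  (* Each entry depends on the index alone, so the iteration runs along the identity. *)
  apply (proj1 (definable_range M hM (fun x => x) (definable_var 0) empty (M_empty hM)
    (fun x _ _ => ⟨empty, opair_name
       (upair_name (opair_name (indexed_name numeral_name x) (indexed_name numeral_name x))
          (opair_name (indexed_name numeral_name x) (indexed_name numeral_name x)))
       (indexed_name (fun k => opair_name empty (chain_name k)) x)⟩) H') tt (fun _ => empty)).
  intros _; apply (M_empty hM).
Qed.

Lemma definable_pair_name s t : mterm hM s -> mterm hM t ->
  mterm hM (fun i e => pair_name (s i e) (t i e)).
Proof.
  intros; pose proof (M_const hM _ (M_empty hM)); unfold pair_name; definability.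
  apply definable_opair_name; apply (definable_apply (indexed_name numeral_name)); auto;
    apply definable_real_name.
Qed.

Lemma M_pair_name i j : M (pair_name (num i) (num j)).
Proof.
  apply (opair_cl (U := model_family hM) tt); [apply (M_empty hM) |].
  apply (M_opair_name M hM); apply M_real_name.
Qed.

(** Its finite subsets are exactly the names [relation_name g]. Evaluating them all gives a set of
    M[G] that contains every finite injection of X. *)
Definition pair_names : V :=
  union (image (fun x => image (fun y => pair_name x y) omega) omega).

Lemma mem_pair_names z : z ∈ pair_names <-> exists i j, z = pair_name (num i) (num j).
Proof.
  unfold pair_names; rewrite mem_union; split.
  - intros (w & Hw & Hz); apply mem_image in Hw as (x & Hx & ->).
    apply mem_image in Hz as (y & Hy & ->).
    apply mem_omega in Hx as [i ->]; apply mem_omega in Hy as [j ->]; eauto.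
  - intros (i & j & ->); exists (image (fun y => pair_name (num i) y) omega).
    split; apply mem_image; [exists (num i) | exists (num j)]; split; auto; apply mem_omega; eauto.
Qed.

Lemma M_pair_names : M pair_names.
Proof.
  apply (M_union hM).
  apply (M_image hM (fun x _ => image (fun y => pair_name x y) omega) (fun _ => empty));
    [| intros _; apply (M_empty hM) | apply (M_omega M hM)].
  pose proof (M_const hM _ (M_omega M hM)).
  model_definability; apply definable_pair_name; definability.
Qed.

Lemma M_relation_name g : M (relation_name g).
Proof.
  apply (M_finite M hM); [apply finite_relation_name |].
  intros z Hz; apply mem_relation_name in Hz as (i & j & _ & ->); apply M_pair_name.
Qed.

Lemma finite_pair_names u : finite u -> (forall z, z ∈ u -> z ∈ pair_names) ->
  exists g, u = relation_name g.
Proof.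
  intros Hf; pattern u; apply finite_cup_ind; auto.
  - intros _; exists nil; apply V_ext; intros z; rewrite mem_relation_name; split.
    + intros H; now apply mem_empty in H.
    + intros (i & j & [] & _).
  - intros x y _ IH H; destruct IH as [g ->].
    { intros z Hz; apply H, mem_cup; auto. }
    destruct (proj1 (mem_pair_names y)) as (i & j & ->).
    { apply H, mem_cup; right; apply mem_upair; auto. }
    exists ((i, j) :: g); apply V_ext; intros z; rewrite mem_cup, mem_upair, !mem_relation_name; split.
    + intros [(i' & j' & Hg & ->) | Hz]; [exists i', j'; simpl; auto |].
      exists i, j; simpl; tauto.
    + intros (i' & j' & [E | Hg] & ->); [injection E as -> ->; auto | left; eauto].
Qed.

(** ** Symmetry *)

Lemma act_upair_name f s t : act f (upair_name s t) = upair_name (act f s) (act f t).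
Proof.
  unfold upair_name; apply V_ext; intros z; rewrite mem_act, mem_upair; split.
  - intros (p & u & H & ->); apply mem_upair in H as [E | E]; apply opair_inj in E as [-> ->];
      rewrite act_cond_empty; auto.
  - intros [-> | ->]; exists empty; [exists s | exists t]; rewrite act_cond_empty; split; auto;
      apply mem_upair; auto.
Qed.

Lemma act_opair_name f s t : act f (opair_name s t) = opair_name (act f s) (act f t).
Proof. unfold opair_name; now rewrite !act_upair_name. Qed.

(** Only the weakest condition occurs hereditarily, as in canonical names of ground model sets;
    every automorphism fixes such a name. *)
Inductive pure (t : V) : Prop :=
| pure_intro : (forall z, z ∈ t -> exists s, z = ⟨empty, s⟩ /\ pure s) -> pure t.

Lemma pure_empty : pure empty.
Proof. constructor; intros z Hz; now apply mem_empty in Hz. Qed.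

Lemma pure_upair_name s t : pure s -> pure t -> pure (upair_name s t).
Proof.
  intros Hs Ht; constructor; intros z Hz; apply mem_upair in Hz as [-> | ->]; eauto.
Qed.

Lemma pure_opair_name s t : pure s -> pure t -> pure (opair_name s t).
Proof. intros; now repeat apply pure_upair_name. Qed.

Lemma pure_numeral_name k : pure (numeral_name k).
Proof.
  induction k as [|k IH]; [apply pure_empty |].
  constructor; intros z Hz; apply mem_cup in Hz as [Hz | Hz].
  - destruct IH as [IH]; auto.
  - apply mem_singleton in Hz as ->; eauto.
Qed.

Lemma pure_chain_name k : pure (chain_name k).
Proof.
  induction k as [|k IH]; [apply pure_empty |].
  constructor; intros z Hz; apply mem_singleton in Hz as ->; eexists; split; auto.
  apply pure_opair_name; auto; apply pure_empty.
Qed.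

Lemma act_pure f t : pure t -> act f t = t.
Proof.
  induction t as [t IH] using (well_founded_ind in_name_wf); intros [Ht].
  apply V_ext; intros z; rewrite mem_act; split.
  - intros (p & s & H & ->); destruct (Ht _ H) as (s' & E & Hs).
    apply opair_inj in E as [-> <-]; rewrite act_cond_empty, IH; auto; now exists empty.
  - intros H; destruct (Ht _ H) as (s & -> & Hs); exists empty, s; split; auto.
    rewrite act_cond_empty, IH; auto; now exists empty.
Qed.

Lemma hs_pure t : pure t -> hereditarily_symmetric t.
Proof.
  induction t as [t IH] using (well_founded_ind in_name_wf); intros Ht; split.
  - exists 0; intros f _; now apply act_pure.
  - intros p s H; apply IH; [now exists p |]; destruct Ht as [Ht].
    destruct (Ht _ H) as (s' & E & Hs); now apply opair_inj in E as [_ ->].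
Qed.

Lemma name_pure t : pure t -> is_name P t.
Proof.
  induction t as [t IH] using (well_founded_ind in_name_wf); intros [Ht]; split.
  intros z Hz; destruct (Ht z Hz) as (s & -> & Hs); exists empty, s; split_and; auto.
  - now apply Fn_empty.
  - apply IH; auto; now exists empty.
Qed.

Lemma hs_upair_name s t : hereditarily_symmetric s -> hereditarily_symmetric t ->
  hereditarily_symmetric (upair_name s t).
Proof.
  intros Hs Ht; split.
  - destruct Hs as [[m Hm] _], Ht as [[n Hn] _]; exists (m + n); intros f [Hf Hfix].
    rewrite act_upair_name, Hm, Hn; auto; split; auto; intros; apply Hfix; lia.
  - intros p u H; apply mem_upair in H as [E | E]; now apply opair_inj in E as [_ ->].
Qed.

Lemma hs_opair_name s t : hereditarily_symmetric s -> hereditarily_symmetric t ->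
  hereditarily_symmetric (opair_name s t).
Proof. intros; now repeat apply hs_upair_name. Qed.

Lemma name_upair_name s t : is_name P s -> is_name P t -> is_name P (upair_name s t).
Proof.
  intros Hs Ht; split; intros z Hz; pose proof (Fn_empty M hM).
  apply mem_upair in Hz as [-> | ->]; eauto.
Qed.

Lemma name_opair_name s t : is_name P s -> is_name P t -> is_name P (opair_name s t).
Proof. intros; now repeat apply name_upair_name. Qed.

Lemma act_bit f n k : act_cond f (bit (num n) (num k)) = bit (num (f n)) (num k).
Proof.
  apply V_ext; intros z; unfold bit; rewrite mem_act_cond, mem_singleton; split.
  - intros (i & j & b & H & ->); apply mem_singleton in H.
    apply opair_inj in H as [E ->]; apply opair_inj in E as [E1 ->].
    now apply num_inj in E1 as ->.
  - intros ->; exists n, k, (num 1); split; auto; now apply mem_singleton.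
Qed.

Lemma Fn_bit n k : P (bit (num n) (num k)).
Proof.
  replace (bit (num n) (num k)) with
    (cup empty (upair ⟨⟨num n, num k⟩, num 1⟩ ⟨⟨num n, num k⟩, num 1⟩)).
  - apply (Fn_extend M hM); auto; [now apply Fn_empty | intros v H; now apply mem_empty in H].
  - apply V_ext; intros z; unfold bit, singleton; rewrite mem_cup; split; auto.
    intros [H | H]; auto; now apply mem_empty in H.
Qed.

Lemma act_indexed_name f s n : (forall k, pure (s k)) ->
  act f (indexed_name s (num n)) = indexed_name s (num (f n)).
Proof.
  intros Hs; apply V_ext; intros z; unfold indexed_name; rewrite mem_act, mem_range; split.
  - intros (p & u & H & ->); apply mem_range in H as [k E]; apply opair_inj in E as [-> ->].
    exists k; now rewrite act_bit, act_pure.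
  - intros [k ->]; exists (bit (num n) (num k)), (s k); rewrite mem_range; split; eauto.
    now rewrite act_bit, act_pure.
Qed.

Lemma hs_indexed_name s n : (forall k, pure (s k)) ->
  hereditarily_symmetric (indexed_name s (num n)).
Proof.
  intros Hs; split.
  - exists (S n); intros f [_ Hf]; rewrite act_indexed_name, Hf; auto.
  - intros p u H; apply mem_range in H as [k E]; apply opair_inj in E as [_ ->]; now apply hs_pure.
Qed.

Lemma name_indexed_name s n : (forall k, pure (s k)) -> is_name P (indexed_name s (num n)).
Proof.
  intros Hs; split; intros z Hz; apply mem_range in Hz as [k ->].
  exists (bit (num n) (num k)), (s k); split_and; auto; [apply Fn_bit | now apply name_pure].
Qed.

Lemma pure_value_entry k : pure (opair_name empty (chain_name k)).
Proof. apply pure_opair_name; [apply pure_empty | apply pure_chain_name]. Qed.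

Lemma Grp_surjective f : Grp f -> forall m, exists n, f n = m.
Proof.
  induction 1 as [|i j f Hij _ IH]; intros m; [eauto |].
  destruct (IH (swap i j m)) as [n Hn]; exists n; now rewrite Hn, swap_involutive.
Qed.

Lemma act_fixed_points_entry f n :
  act f (opair_name (fixed_point_name n) (value_name n)) =
  opair_name (fixed_point_name (f n)) (value_name (f n)).
Proof.
  unfold fixed_point_name, value_name, real_name.
  rewrite !act_opair_name, !act_upair_name, !act_opair_name, !act_indexed_name; auto.
  - apply pure_value_entry.
  - apply pure_numeral_name.
Qed.

Lemma hs_fixed_points_name : hereditarily_symmetric fixed_points_name.
Proof.
  split.
  - exists 0; intros f [Hf _]; unfold fixed_points_name; apply V_ext; intros z.
    rewrite mem_act, mem_range; split.
    + intros (p & s & H & ->); apply mem_range in H as [n E]; apply opair_inj in E as [-> ->].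
      exists (f n); now rewrite act_fixed_points_entry, act_cond_empty.
    + intros [m ->]; destruct (Grp_surjective f Hf m) as [n <-].
      exists empty, (opair_name (fixed_point_name n) (value_name n)); rewrite mem_range.
      split; [eauto | now rewrite act_fixed_points_entry, act_cond_empty].
  - intros p s H; apply mem_range in H as [n E]; apply opair_inj in E as [_ ->].
    pose proof (hs_indexed_name _ n pure_numeral_name); pose proof (hs_indexed_name _ n pure_value_entry).
    apply hs_opair_name; [apply hs_upair_name; apply hs_opair_name; assumption | assumption].
Qed.

Lemma name_fixed_points_name : is_name P fixed_points_name.
Proof.
  split; intros z Hz; apply mem_range in Hz as [n ->].
  exists empty, (opair_name (fixed_point_name n) (value_name n)); split_and; auto; [now apply Fn_empty |].
  pose proof (name_indexed_name _ n pure_numeral_name); pose proof (name_indexed_name _ n pure_value_entry).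
  apply name_opair_name; [apply name_upair_name; apply name_opair_name; assumption | assumption].
Qed.

Lemma hs_relation_name g : hereditarily_symmetric (relation_name g).
Proof.
  assert (HB : exists N, forall i j, In (i, j) g -> i < N /\ j < N).
  { induction g as [|[i j] g [N IH]]; [exists 0; intros i j [] |].
    exists (N + S i + S j); intros i' j' [E | H]; [injection E as -> ->; lia | apply IH in H; lia]. }
  destruct HB as [N HB].
  pose proof (fun n => hs_indexed_name _ n pure_numeral_name) as Hr.
  split.
  - exists N; intros f [_ Hf].
    assert (Hact : forall i j, In (i, j) g ->
      act f (opair_name (indexed_name numeral_name (num i)) (indexed_name numeral_name (num j)))
      = opair_name (indexed_name numeral_name (num i)) (indexed_name numeral_name (num j))).
    { intros i j Hij; apply HB in Hij as [Hi Hj].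
      rewrite act_opair_name, !act_indexed_name by apply pure_numeral_name; now rewrite !Hf. }
    apply V_ext; intros z; rewrite mem_act, mem_relation_name; split.
    + intros (p & s & H & ->); apply mem_relation_name in H as (i & j & Hij & E).
      apply opair_inj in E as [-> ->]; exists i, j; rewrite Hact, act_cond_empty; auto.
    + intros (i & j & Hij & ->); exists empty,
        (opair_name (indexed_name numeral_name (num i)) (indexed_name numeral_name (num j))).
      rewrite mem_relation_name, Hact, act_cond_empty by auto; split; auto; exists i, j; auto.
  - intros p s H; apply mem_relation_name in H as (i & j & Hij & E).
    apply opair_inj in E as [_ ->]; now apply hs_opair_name.
Qed.

Lemma name_relation_name g : is_name P (relation_name g).
Proof.
  split; intros z Hz; apply mem_relation_name in Hz as (i & j & Hij & ->).
  eexists; eexists; split; [reflexivity |]; split; [now apply Fn_empty |].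
  apply name_opair_name; apply name_indexed_name, pure_numeral_name.
Qed.

(** ** Values of the names *)

Section Values.
Variable G : V -> Prop.
Hypothesis hG : generic M P rev_incl G.

Lemma filter_empty : G empty.
Proof. now apply (generic_empty M hM). Qed.

Lemma val_numeral_name k : val G (numeral_name k) = num k.
Proof.
  induction k as [|k IH]; [apply val_empty |].
  rewrite num_succ, <- IH; apply V_ext; intros z; rewrite mem_cup, mem_upair.
  rewrite mem_val; split.
  - intros (p & s & H & Hp & ->); apply mem_cup in H as [H | H].
    + left; apply mem_val; eauto.
    + apply mem_singleton, opair_inj in H as [_ ->]; auto.
  - intros [H | H].
    + apply mem_val in H as (p & s & H & Hp & ->); exists p, s; split_and; auto.
      apply mem_cup; auto.
    + exists empty, (numeral_name k); split_and; [| apply filter_empty | tauto].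
      apply mem_cup; right; now apply mem_singleton.
Qed.

Lemma val_chain_name k : val G (chain_name k) = chain k.
Proof.
  induction k as [|k IH]; [apply val_empty |].
  apply V_ext; intros z; simpl; rewrite mem_val, mem_singleton; split.
  - intros (p & s & H & Hp & ->); apply mem_singleton, opair_inj in H as [_ ->].
    rewrite val_opair_name, val_empty by apply filter_empty; now rewrite <- IH.
  - intros ->; exists empty, (opair_name empty (chain_name k)); split_and.
    + now apply mem_singleton.
    + apply filter_empty.
    + rewrite val_opair_name, val_empty by apply filter_empty; now rewrite <- IH.
Qed.

Lemma filter_bit n k : G (bit (num n) (num k)) <-> num k ∈ cohen_real G n.
Proof.
  rewrite mem_cohen_real; split.
  - intros H; exists k, (bit (num n) (num k)); split_and; auto; now apply mem_singleton.
  - intros (k' & p & Hp & H & E); apply num_inj in E as <-.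
    apply (generic_up M G hG p); auto; [apply Fn_bit |].
    intros z Hz; now apply mem_singleton in Hz as ->.
Qed.

Lemma mem_val_indexed_name s n z : z ∈ val G (indexed_name s (num n)) <->
  exists k, num k ∈ cohen_real G n /\ z = val G (s k).
Proof.
  rewrite mem_val; split.
  - intros (p & u & H & Hp & ->); apply mem_range in H as [k E]; apply opair_inj in E as [-> ->].
    exists k; split; auto; now apply filter_bit.
  - intros (k & Hk & ->); exists (bit (num n) (num k)), (s k); split_and; auto.
    + apply mem_range; eauto.
    + now apply filter_bit.
Qed.

Lemma val_real_name n : val G (real_name n) = cohen_real G n.
Proof.
  apply V_ext; intros z; unfold real_name; rewrite mem_val_indexed_name; split.
  - intros (k & Hk & ->); now rewrite val_numeral_name.
  - intros H; pose proof H as H'; apply mem_cohen_real in H' as (k & p & _ & _ & ->).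
    exists k; now rewrite val_numeral_name.
Qed.

Lemma val_value_name n : val G (value_name n) = value (cohen_real G n).
Proof.
  apply V_ext; intros z; unfold value_name; rewrite mem_val_indexed_name, mem_value.
  split; intros (k & Hk & ->); exists k; split; auto;
    now rewrite val_opair_name, val_empty, val_chain_name by apply filter_empty.
Qed.

Lemma mem_val_fixed_points_name z : z ∈ val G fixed_points_name <->
  exists n, z = ⟨fixed_point (cohen_real G n), value (cohen_real G n)⟩.
Proof.
  assert (E : forall n, val G (opair_name (fixed_point_name n) (value_name n)) =
    ⟨fixed_point (cohen_real G n), value (cohen_real G n)⟩).
  { intros n; unfold fixed_point_name; pose proof filter_empty.
    rewrite !val_opair_name, val_upair_name, val_opair_name by auto.
    now rewrite val_value_name, val_real_name. }
  rewrite mem_val; split.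
  - intros (p & s & H & Hp & ->); apply mem_range in H as [n H]; apply opair_inj in H as [_ ->]; eauto.
  - intros [n ->]; exists empty, (opair_name (fixed_point_name n) (value_name n)); split_and; auto.
    + apply mem_range; eauto.
    + apply filter_empty.
Qed.

Lemma val_relation_name g : val G (relation_name g) = relation (cohen_real G) g.
Proof.
  assert (E : forall i j, val G (opair_name (indexed_name numeral_name (num i))
      (indexed_name numeral_name (num j))) = ⟨cohen_real G i, cohen_real G j⟩).
  { intros i j; rewrite val_opair_name by apply filter_empty; f_equal; apply val_real_name. }
  apply V_ext; intros z; rewrite mem_val, mem_relation; split.
  - intros (p & s & H & Hp & ->); apply mem_relation_name in H as (i & j & Hij & H).
    apply opair_inj in H as [_ ->]; eauto.
  - intros (i & j & Hij & ->); rewrite <- E; eexists; eexists; split_and; [| | reflexivity].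
    + apply mem_relation_name; exists i, j; split; [auto | reflexivity].
    + apply filter_empty.
Qed.

End Values.
End Names.

(** * Finite injections between Cohen reals *)

(** [Inj] without a class to which the conditions belong. In this form the poset depends on X alone,
    hence is literally the same for a filter and its transpositions; [Inj_cohen_model] identifies it
    with the poset of the symmetric model. *)
Definition injection_on (X r : V) : Prop :=
  finite r /\
  (forall z, z ∈ r -> exists x y, x ∈ X /\ y ∈ X /\ z = ⟨x, y⟩) /\
  (forall x y y', ⟨x, y⟩ ∈ r -> ⟨x, y'⟩ ∈ r -> y = y') /\
  (forall x x' y, ⟨x, y⟩ ∈ r -> ⟨x', y⟩ ∈ r -> x = x').

Definition list_injection (g : list (nat * nat)) : Prop :=
  (forall i j j', In (i, j) g -> In (i, j') g -> j = j') /\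
  (forall i i' j, In (i, j) g -> In (i', j) g -> i = i').

Lemma list_injection_cons n g : list_injection g ->
  (forall i, ~ In (n, i) g /\ ~ In (i, n) g) -> list_injection ((n, n) :: g).
Proof.
  intros [H1 H2] Hn.
  split; intros i j k [E | H] [E' | H']; try (injection E; intros; subst);
    try (injection E'; intros; subst); try congruence; eauto;
    first [destruct (Hn i); contradiction | destruct (Hn j); contradiction
      | destruct (Hn k); contradiction].
Qed.

Lemma injection_empty X : injection_on X empty.
Proof.
  split; [exists nil; intros z Hz | split; [intros z Hz | split; intros x y y' Hz]];
    now apply mem_empty in Hz.
Qed.

Lemma chain_separated Q p k m : Q p ->
  forces_eq Q rev_incl p (chain k) (chain m) -> k = m.
Proof.
  revert p m; induction k as [|k IH]; intros p [|m] Hp H; auto; apply forces_eq_inv in H as [H1 H2].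
  - destruct (H2 p empty (chain m)) as (r & s & c & _ & _ & H & _); auto using rev_incl_refl.
    + now apply mem_singleton.
    + intros z Hz; now apply mem_empty in Hz.
    + now apply mem_empty in H.
  - destruct (H1 p empty (chain k)) as (r & s & c & _ & _ & H & _); auto using rev_incl_refl.
    + now apply mem_singleton.
    + intros z Hz; now apply mem_empty in Hz.
    + now apply mem_empty in H.
  - destruct (H1 p empty (chain k)) as (r & s & c & Hr & _ & H & _ & E); auto using rev_incl_refl.
    + now apply mem_singleton.
    + intros z Hz; now apply mem_empty in Hz.
    + apply mem_singleton, opair_inj in H as [_ ->]; f_equal; eauto.
Qed.

(** The entry [chain k] of the first code would have to be forced equal to some [chain m] with m in
    [y], and then k = m. *)
Lemma value_separated Q p x y k : Q p -> num k ∈ x -> ~ num k ∈ y ->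
  ~ forces_eq Q rev_incl p (value x) (value y).
Proof.
  intros Hp Hx Hy H; apply forces_eq_inv in H as [H _].
  destruct (H p empty (chain k)) as (r & s & c & Hr & _ & Hs & _ & E); auto using rev_incl_refl.
  - apply mem_value; eauto.
  - intros z Hz; now apply mem_empty in Hz.
  - apply mem_value in Hs as (m & Hm & Es); apply opair_inj in Es as [_ ->].
    apply chain_separated in E as ->; auto.
Qed.

Lemma name_chain (Q : V -> Prop) k : Q empty -> is_name Q (chain k).
Proof.
  intros H0; induction k as [|k IH]; split; intros z Hz.
  - now apply mem_empty in Hz.
  - apply mem_singleton in Hz as ->; eauto.
Qed.

Lemma name_value (Q : V -> Prop) x : Q empty -> is_name Q (value x).
Proof.
  intros H0; split; intros z Hz; apply mem_value in Hz as (k & _ & ->).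
  exists empty, (chain k); split_and; auto; now apply name_chain.
Qed.

Section Injections.
Variable M : V -> Prop.
Hypothesis hM : ctm M.
Notation P := (Fn M).

Section Generic.
Variable G : V -> Prop.
Hypothesis hG : generic M P rev_incl G.
Notation x := (cohen_real G).
Notation X := (cohen_set G).

Lemma mem_relation_pair i j g : ⟨x i, x j⟩ ∈ relation x g <-> In (i, j) g.
Proof.
  rewrite mem_relation; split; [|eauto].
  intros (i' & j' & H & E); apply opair_inj in E as [E1 E2].
  apply (cohen_real_inj M hM G hG) in E1, E2; now subst.
Qed.

Lemma relation_injection g : list_injection g -> injection_on X (relation x g).
Proof.
  intros [H1 H2]; split; [apply finite_relation |]; split; [|split].
  - intros z Hz; apply mem_relation in Hz as (i & j & _ & ->).
    exists (x i), (x j); rewrite !mem_cohen_set; eauto.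
  - intros u v w Hv Hw; apply mem_relation in Hv as (i & j & Hij & E).
    apply opair_inj in E as [-> ->]; apply mem_relation in Hw as (i' & j' & Hij' & E).
    apply opair_inj in E as [E ->]; apply (cohen_real_inj M hM G hG) in E as <-.
    f_equal; eauto.
  - intros u v w Hv Hw; apply mem_relation in Hv as (i & j & Hij & E).
    apply opair_inj in E as [-> ->]; apply mem_relation in Hw as (i' & j' & Hij' & E).
    apply opair_inj in E as [-> E]; apply (cohen_real_inj M hM G hG) in E as <-.
    f_equal; eauto.
Qed.

Lemma injection_relation r : injection_on X r -> exists g, r = relation x g /\ list_injection g.
Proof.
  intros (Hf & Hs & H1 & H2).
  assert (Hg : exists g, r = relation x g).
  { clear H1 H2; revert Hs; pattern r; apply finite_cup_ind; auto.
    - intros _; exists nil; apply V_ext; intros z; rewrite mem_relation; split.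
      + intros H; now apply mem_empty in H.
      + intros (i & j & [] & _).
    - intros u y _ IH H; destruct IH as [g ->].
      { intros z Hz; apply H, mem_cup; auto. }
      destruct (H y) as (v & w & Hv & Hw & ->).
      { apply mem_cup; right; apply mem_upair; auto. }
      apply mem_cohen_set in Hv as [i ->]; apply mem_cohen_set in Hw as [j ->].
      exists ((i, j) :: g); apply V_ext; intros z; rewrite mem_cup, mem_upair, !mem_relation; split.
      + intros [(i' & j' & Hg & ->) | Hz]; [exists i', j'; simpl; auto |].
        exists i, j; simpl; tauto.
      + intros (i' & j' & [E | Hg] & ->); [injection E as -> ->; auto | left; eauto]. }
  destruct Hg as [g ->]; exists g; split; auto; split.
  - intros i j j' Hj Hj'; apply mem_relation_pair in Hj, Hj'.
    apply (cohen_real_inj M hM G hG), (H1 (x i)); auto.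
  - intros i i' j Hi Hi'; apply mem_relation_pair in Hi, Hi'.
    apply (cohen_real_inj M hM G hG), (H2 _ _ (x j)); auto.
Qed.

Lemma cohen_model_relation g : cohen_model M G (relation x g).
Proof.
  exists (relation_name g); split_and.
  - now apply M_relation_name.
  - now apply name_relation_name.
  - now apply hs_relation_name.
  - now rewrite (val_relation_name M hM).
Qed.

Lemma Inj_cohen_model : Inj (cohen_model M G) X X = injection_on X.
Proof.
  extensionality r; apply propositional_extensionality; unfold Inj, injection_on; split; [tauto |].
  intros H; split; auto; destruct (injection_relation r H) as (g & -> & _).
  apply cohen_model_relation.
Qed.

Lemma mem_val_finite_relations r :
  r ∈ val G (set_name (finite_subsets pair_names)) <-> exists g, r = relation x g.
Proof.
  rewrite mem_val_set_name by now apply (generic_empty M hM).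
  split.
  - intros (u & Hu & ->); apply mem_finite_subsets in Hu as [Hf Hs].
    destruct (finite_pair_names u Hf Hs) as [g ->]; exists g; now rewrite (val_relation_name M hM).
  - intros [g ->]; exists (relation_name g); split; [|now rewrite (val_relation_name M hM)].
    apply mem_finite_subsets; split; [apply finite_relation_name |].
    intros z Hz; apply mem_relation_name in Hz as (i & j & _ & ->).
    apply mem_pair_names; eauto.
Qed.

End Generic.

Notation extension_family := (extension_family M hM).

(** Being a finite relation on X is expressed as membership in the value of one fixed name, which is
    an admissible parameter of [extension_family]. *)
Lemma definable_injection :
  @definable extension_family (fun G e => injection_on (cohen_set (proj1_sig G)) (e 0)).
Proof.
  pose proof (extension_const M hM _ (M_set_name M hM _ (M_finite_subsets M hM _ (M_pair_names M hM))))
    as HFR.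
  apply definable_iff with (fun G e => e 0 ∈ val (proj1_sig G) (set_name (finite_subsets pair_names)) /\
    (forall x, fam_cl extension_family G x -> forall y, fam_cl extension_family G y ->
     forall y', fam_cl extension_family G y' -> ⟨x, y⟩ ∈ e 0 -> ⟨x, y'⟩ ∈ e 0 -> y = y') /\
    (forall x, fam_cl extension_family G x -> forall x', fam_cl extension_family G x' ->
     forall y, fam_cl extension_family G y -> ⟨x, y⟩ ∈ e 0 -> ⟨x', y⟩ ∈ e 0 -> x = x')).
  - intros [G hG] e He; cbn [proj1_sig].
    pose proof (opair_mem_cl (U := extension_family) (exist _ G hG)) as Hcl.
    rewrite mem_val_finite_relations by auto; split.
    + intros H; pose proof (injection_relation G hG _ H) as (g & Hg & _).
      destruct H as (_ & _ & H1 & H2); split; [eauto |]; split.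
      * intros u _ v _ w _; apply H1.
      * intros u _ v _ w _; apply H2.
    + intros [[g Hg] [H1 H2]]; split; [rewrite Hg; apply finite_relation |]; split; [|split].
      * intros z Hz; rewrite Hg in Hz; apply mem_relation in Hz as (i & j & _ & ->).
        exists (cohen_real G i), (cohen_real G j); rewrite !mem_cohen_set; eauto.
      * intros u v w Hv Hw; destruct (Hcl _ _ _ (He 0) Hv), (Hcl _ _ _ (He 0) Hw).
        apply (H1 u); auto.
      * intros u v w Hv Hw; destruct (Hcl _ _ _ (He 0) Hv), (Hcl _ _ _ (He 0) Hw).
        apply (H2 u) with w; auto.
  - definability.
Qed.

Lemma definable_injection_forces r s t : M r -> M s -> M t ->
  @definable extension_family (fun G _ =>
    injection_on (cohen_set (proj1_sig G)) (val (proj1_sig G) r) /\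
    forces_eq (injection_on (cohen_set (proj1_sig G))) rev_incl
      (val (proj1_sig G) r) (val (proj1_sig G) s) (val (proj1_sig G) t)).
Proof.
  intros Mr Ms Mt.
  apply (definable_subst (U := extension_family) (fun G u _ =>
    injection_on (cohen_set (proj1_sig G)) u /\ forces_eq (injection_on (cohen_set (proj1_sig G)))
      rev_incl u (val (proj1_sig G) s) (val (proj1_sig G) t))); [|now apply extension_const].
  apply (definable_subst (U := extension_family) (fun G u e =>
    injection_on (cohen_set (proj1_sig G)) (e 0) /\
    forces_eq (injection_on (cohen_set (proj1_sig G))) rev_incl (e 0) u (val (proj1_sig G) t)));
    [|now apply extension_const].
  apply (definable_subst (U := extension_family) (fun G u e =>
    injection_on (cohen_set (proj1_sig G)) (e 1) /\
    forces_eq (injection_on (cohen_set (proj1_sig G))) rev_incl (e 1) (e 0) u));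
    [|now apply extension_const].
  apply (forces_eq_definable (U := extension_family) (fun G => injection_on (cohen_set (proj1_sig G)))).
  - apply definable_injection.
  - intros [G hG]; exists (val G (set_name (finite_subsets pair_names))); split.
    + exists (set_name (finite_subsets pair_names)); split; auto.
      apply M_set_name, M_finite_subsets, M_pair_names; auto.
    + intros p Hp; apply (mem_val_finite_relations G hG).
      destruct (injection_relation G hG p Hp) as (g & Hg & _); eauto.
  - intros [G hG] a b; now apply extension_product.
  - intros [G hG] a; now apply extension_transitive_superset.
Qed.

End Injections.

(** * Failure of the maximum principle *)

Lemma list_injection_bound (g : list (nat * nat)) :
  exists N, forall i j, In (i, j) g -> i < N /\ j < N.
Proof.
  induction g as [|[i j] g [N IH]]; [exists 0; intros i j [] |].
  exists (N + S i + S j); intros i' j' [E | H]; [injection E as -> ->; lia | apply IH in H; lia].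
Qed.

(** As a condition this sends x_i to x_(i+1) for i < n, so no injection extending it has a fixed
    point among the first n reals. *)
Lemma shift_injection n : list_injection (map (fun i => (i, S i)) (seq 0 n)).
Proof.
  split; intros i j k H1 H2; apply in_map_iff in H1 as (a & E1 & _), H2 as (b & E2 & _);
    injection E1; injection E2; intros; lia.
Qed.

Theorem theorem7 (M G : V -> Prop)
    (hM : ctm M)
    (hG : generic M (Fn M) rev_incl G) :
  ~ maximum_principle (cohen_model M G)
      (Inj (cohen_model M G) (cohen_set G) (cohen_set G)) rev_incl.
Proof.
  rewrite (Inj_cohen_model M hM G hG); intros Hmax.
  set (X := cohen_set G) in *; set (x := cohen_real G).
  pose (sigma := val G fixed_points_name).
  assert (mem_sigma : forall z, z ∈ sigma <-> exists n, z = ⟨fixed_point (x n), value (x n)⟩)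
    by (intros z; now apply (mem_val_fixed_points_name M hM)).
  assert (Q0 : injection_on X empty) by apply injection_empty.
  assert (Hsigma : cohen_model M G sigma /\ is_name (injection_on X) sigma).
  { split.
    - exists fixed_points_name; split_and; auto; [now apply M_fixed_points_name |
        now apply name_fixed_points_name | now apply hs_fixed_points_name].
    - split; intros z Hz; apply mem_sigma in Hz as [n ->].
      exists (fixed_point (x n)), (value (x n)); split_and; auto; [|now apply name_value].
      replace (fixed_point (x n)) with (relation x ((n, n) :: nil)).
      + apply (relation_injection M hM G hG); split; intros i j k H1 H2; simpl in H1, H2;
          intuition congruence.
      + apply V_ext; intros z; unfold fixed_point; rewrite mem_relation, mem_singleton; split.
        * intros (i & j & [E | []] & ->); now injection E as -> ->.
        * intros ->; exists n, n; simpl; auto. }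
  destruct (proj1 (Hmax empty Q0 (fMem 0 1) (fun _ => sigma) (fun _ => Hsigma)))
    as (t & (tn & Mtn & Htn & HStn & Et) & _ & Ht).
  (* Existence is forced: only finitely many indices occur in a condition, and the pair (x_N, x_N)
     can be added for an [N] beyond them. It then forces the code of x_N into σ. *)
  - intros q Hq _; destruct (injection_relation M hM G hG q Hq) as (g & -> & Hg).
    destruct (list_injection_bound g) as [N HN].
    assert (Hr : injection_on X (relation x ((N, N) :: g))).
    { apply (relation_injection M hM G hG).
      apply list_injection_cons; auto; intros i; split; intros H; apply HN in H; lia. }
    exists (relation x ((N, N) :: g)); split; auto; split.
    { intros z Hz; apply mem_relation in Hz as (i & j & Hij & ->).
      apply mem_relation; exists i, j; simpl; auto. }
    exists (value (x N)); split; [|split; [now apply name_value |]].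
    + exists (value_name N); split_and.
      * now apply M_value_name.
      * apply (name_indexed_name M hM _ N pure_value_entry).
      * apply (hs_indexed_name _ N pure_value_entry).
      * symmetry; now apply (val_value_name M hM).
    + intros r Hr' Hle; exists r, (fixed_point (x N)), (value (x N)); split_and; auto.
      * apply rev_incl_refl.
      * apply mem_sigma; eauto.
      * intros z Hz; apply mem_singleton in Hz as ->; apply Hle, mem_relation.
        exists N, N; simpl; auto.
      * apply forces_eq_refl; apply rev_incl_refl.
  - destruct HStn as [[n Hn] _].
    destruct (Ht (relation x (map (fun i => (i, S i)) (seq 0 n))))
      as (r & s & d & Hr & Hrq & Hd & Hrs & Heq).
    { apply (relation_injection M hM G hG), shift_injection. }
    { intros z Hz; now apply mem_empty in Hz. }
    simpl in Hd, Heq; apply mem_sigma in Hd as [a E]; apply opair_inj in E as [-> ->].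
    destruct (injection_relation M hM G hG r Hr) as (g & -> & Hg).
    assert (Haa : In (a, a) g).
    { apply (mem_relation_pair M hM G hG), Hrs, mem_singleton; auto. }
    assert (Hna : n <= a).
    { destruct (le_lt_dec n a) as [|Han]; auto; exfalso.
      assert (Ha : In (a, S a) g).
      { apply (mem_relation_pair M hM G hG), Hrq, mem_relation; exists a, (S a); split; auto.
        apply in_map_iff; exists a; split; auto; apply in_seq; lia. }
      apply (n_Sn a), (proj1 Hg a); auto. }
    (* The filter enters only through X and the values of three names of [M], so the statement can
       be transferred to another generic filter. *)
    destruct (extension_decided M hM (fun G' => injection_on (cohen_set G') (val G' (relation_name g)) /\
        forces_eq (injection_on (cohen_set G')) rev_incl (val G' (relation_name g)) (val G' tn)
          (val G' (value_name a))) G) as (p & Hp & Hdec); auto.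
    { apply definable_injection_forces; [now apply M_relation_name | auto | now apply M_value_name]. }
    { rewrite (val_relation_name M hM), (val_value_name M hM), <- Et by auto; auto. }
    destruct (list_injection_bound g) as [N HN].
    (* [S a] makes [b] larger than [a]; [N] keeps [b] away from all indices in [g], so that the pair
       (b, b) can be added to [g]. *)
    destruct (fresh_swap M hM G hG a (S a + N) p Hp) as (b & Hb & HGb).
    destruct (Hdec (swapped_filter M G a b)) as [_ Heq'].
    { now apply swapped_generic. }
    { split; auto; now apply (generic_Fn M G hG). }
    rewrite (cohen_set_swapped M hM G a b hG) in Heq'.
    pose proof (swapped_generic M hM G a b hG) as hG'.
    rewrite (val_relation_name M hM), (val_value_name M hM) in Heq' by auto.
    assert (Hfix : fix_below n (swap a b)).
    { split; [apply (@Grp_swap a b (fun m => m)); [lia | apply Grp_id] |].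
      intros i Hi; apply swap_other; lia. }
    (* The transposition fixes the name [tn], as n <= a < b; hence the transposed filter evaluates
       it to the same [t]. *)
    rewrite (val_swapped M G a b tn Htn), (Hn _ Hfix), <- Et in Heq'.
    rewrite (cohen_real_swapped M hM G a b hG), swap_left in Heq'.
    (* This condition extends both [r] and its transposed version, and so forces [t] to equal the
       codes of x_a and of x_b. *)
    assert (Hr' : injection_on X (relation x ((b, b) :: g))).
    { apply (relation_injection M hM G hG).
      apply list_injection_cons; auto; intros i; split; intros H; apply HN in H; lia. }
    destruct (cohen_real_separated M hM G hG a b) as (k & Hka & Hkb); [lia |].
    apply (value_separated _ _ (x a) (x b) k Hr' Hka Hkb).
    pose proof (forces_eq_mono (injection_on X) rev_incl rev_incl_trans) as mono.
    apply (forces_eq_trans _ _ rev_incl_trans) with t.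
    + apply forces_eq_sym; eapply mono; [|exact Heq].
      intros z Hz; apply mem_relation in Hz as (i & j & Hij & ->).
      apply mem_relation; exists i, j; simpl; auto.
    (* In the transposed version of [r] the pair (a, a) has become (b, b). Every other pair of [g]
       avoids [a] by injectivity and [b] by the choice of [b], so it is unchanged. *)
    + eapply mono; [|exact Heq'].
      intros z Hz; apply mem_relation in Hz as (i & j & Hij & ->).
      rewrite !(cohen_real_swapped M hM G a b hG); apply mem_relation.
      destruct Hg as [Hg1 Hg2]; pose proof (HN i j Hij).
      destruct (Nat.eq_dec i a) as [-> | Hi].
      * rewrite (Hg1 a j a Hij Haa), swap_left; exists b, b; simpl; auto.
      * assert (j <> a) by (intros ->; apply Hi, (Hg2 i a a); auto).
        rewrite !swap_other by lia; exists i, j; simpl; auto.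
Qed.
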